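(* Let $(M^{n},g,T)$, $n\geq 3$, be a connected Riemannian spin manifold with a non-trivial 3-form $T$ such that $\nabla^{c}T=0$, and let $s\in\mathbb{R}$. Then any zero point of a twistor spinor with torsion $0\neq\varphi\in\ker(P^{s})$ is isolated, i.e. the zero set of $\varphi$ is discrete.
   Context: $\nabla^{g}$ is the Levi-Civita connection; $\nabla^{s}$ is the metric connection $g(\nabla^{s}_{X}Y,Z)=g(\nabla^{g}_{X}Y,Z)+2s\,T(X,Y,Z)$, and $\nabla^{c}:=\nabla^{1/4}=\nabla^{g}+\frac12T$. $\Sigma$ is the spinor bundle, ''$\cdot$'' is Clifford multiplication with $X\cdot Y+Y\cdot X=-2g(X,Y)$; forms act by Clifford multiplication. On $\Sigma$: $\nabla^{s}_{X}\varphi=\nabla^{g}_{X}\varphi+s(X\lrcorner T)\cdot\varphi$ and $D^{s}(\varphi)=\sum_{i}e_{i}\cdot\nabla^{s}_{e_{i}}\varphi$ for a local orthonormal frame $\{e_i\}$. $\varphi\in\ker(P^{s})$ (twistor spinor with torsion) means $\nabla^{s}_{X}\varphi+\frac1nX\cdot D^{s}(\varphi)=0$ for all vector fields $X$. *)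

(* Defs.v *)
(* Manifolds are given by atlases, tensor fields by their components in every
   chart together with the transformation law, and the spin structure by a
   Spin(n)-valued cocycle lifting the transition functions of local oriented
   orthonormal frames.  Vectors are rows. *)
From mathcomp Require Import all_boot all_order all_algebra.
From mathcomp Require Import complex.
From mathcomp Require Import all_classical all_reals all_analysis.
Import Order.TTheory GRing.Theory Num.Theory.
Import numFieldNormedType.Exports.

Set Implicit Arguments.
Unset Strict Implicit.
Unset Printing Implicit Defensive.

Local Open Scope classical_set_scope.
Local Open Scope ring_scope.
Local Open Scope complex_scope.

Record topological_atlas (R : realType) (n : nat) (M : topologicalType) :=
  TopologicalAtlas {
    chart : Type;
    dom : chart -> set M;
    crd : chart -> M -> 'rV[R]_n;
    par : chart -> 'rV[R]_n -> M;
    dom_open : forall i, open (dom i);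
    dom_cover : forall m, exists i, dom i m;
    crd_open : forall i, open (crd i @` dom i);
    crdK : forall i m, dom i m -> par i (crd i m) = m;
    crd_continuous : forall i m, dom i m -> {for m, continuous (crd i)};
    par_continuous :
      forall i m, dom i m -> {for crd i m, continuous (par i)} }.

(* The partial derivative of f along the a-th coordinate of the chart i; it is
   meaningful at the points of dom A i. *)
Definition pd (R : realType) (n : nat) (M : topologicalType)
    (A : topological_atlas R n M) (i : chart A) (a : 'I_n) (f : M -> R) :
    M -> R :=
  fun m => 'D_(delta_mx 0 a) (f \o par i) (crd i m).

Definition pdC (R : realType) (n : nat) (M : topologicalType)
    (A : topological_atlas R n M) (i : chart A) (a : 'I_n) (f : M -> R[i])
    (m : M) : R[i] :=
  pd i a (fun x => complex.Re (f x)) m +i* pd i a (fun x => complex.Im (f x)) m.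

(* Partial derivatives of all orders exist and are continuous on the open
   set U. *)
Definition smooth_on (R : realType) (n : nat) (M : topologicalType)
    (A : topological_atlas R n M) (U : set M) (f : M -> R) : Prop :=
  forall (i : chart A) (s : seq 'I_n) (m : M), dom i m -> U m ->
    {for m, continuous (foldr (pd i) f s)} /\
    (forall a, derivable (foldr (pd i) f s \o par i) (crd i m) (delta_mx 0 a)).

Definition smoothC_on (R : realType) (n : nat) (M : topologicalType)
    (A : topological_atlas R n M) (U : set M) (f : M -> R[i]) : Prop :=
  smooth_on A U (fun m => complex.Re (f m)) /\
  smooth_on A U (fun m => complex.Im (f m)).

(* jac i j m a b is the derivative of the b-th coordinate of j along the a-th
   coordinate of i. *)
Definition jac (R : realType) (n : nat) (M : topologicalType)
    (A : topological_atlas R n M) (i j : chart A) (m : M) : 'M[R]_n :=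
  \matrix_(a, b) pd i a (fun x => crd j x 0 b) m.

Record oriented_atlas (R : realType) (n : nat) (M : topologicalType) :=
  OrientedAtlas {
    atlas_of :> topological_atlas R n M;
    transition_smooth : forall (j : chart atlas_of) b,
      smooth_on atlas_of (dom j) (fun m => crd j m 0 b);
    transition_oriented : forall (i j : chart atlas_of) m,
      dom i m -> dom j m -> 0 < \det (jac i j m) }.

Record riemannian_metric (R : realType) (n : nat) (M : topologicalType)
    (A : oriented_atlas R n M) :=
  RiemannianMetric {
    metric_mx :> chart A -> M -> 'M[R]_n;
    metric_sym : forall i m, dom i m -> (metric_mx i m)^T = metric_mx i m;
    metric_pos : forall i m, dom i m -> forall v : 'rV[R]_n, v != 0 ->
      0 < (v *m metric_mx i m *m v^T) 0 0;
    metric_smooth : forall i a b,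
      smooth_on A (dom i) (fun m => metric_mx i m a b);
    metric_tensorial : forall i j m, dom i m -> dom j m ->
      metric_mx i m = jac i j m *m metric_mx j m *m (jac i j m)^T }.

Record three_form (R : realType) (n : nat) (M : topologicalType)
    (A : oriented_atlas R n M) :=
  ThreeForm {
    form_comp :> chart A -> M -> 'I_n -> 'I_n -> 'I_n -> R;
    form_alt12 : forall i m a b c, dom i m ->
      form_comp i m b a c = - form_comp i m a b c;
    form_alt23 : forall i m a b c, dom i m ->
      form_comp i m a c b = - form_comp i m a b c;
    form_smooth : forall i a b c,
      smooth_on A (dom i) (fun m => form_comp i m a b c);
    form_tensorial : forall i j m a b c, dom i m -> dom j m ->
      form_comp i m a b c =
      \sum_d \sum_e \sum_f jac i j m a d * jac i j m b e * jac i j m c f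
                           * form_comp j m d e f }.

Definition nontrivial_form (R : realType) (n : nat) (M : topologicalType)
    (A : oriented_atlas R n M) (T : three_form A) : Prop :=
  exists i m a b c, dom i m /\ T i m a b c != 0.

Section TangentConnections.
Context (R : realType) (n : nat) (M : topologicalType).
Context (A : oriented_atlas R n M) (g : riemannian_metric A).
Implicit Types (i : chart A) (m : M).

Definition metric_inv i m : 'M[R]_n := invmx (g i m).

(* Christoffel symbols:
   nabla^g_(d_a) d_b = \sum_c (levi_civita i m a b c) d_c. *)
Definition levi_civita i m (a b c : 'I_n) : R :=
  2^-1 * \sum_d metric_inv i m c d *
    (pd i a (fun x => g i x b d) m + pd i b (fun x => g i x a d) m
     - pd i d (fun x => g i x a b) m).

Context (T : three_form A).

(* g(nabla^s_X Y, Z) = g(nabla^g_X Y, Z) + 2 s T(X, Y, Z), solved for the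
   components of nabla^s. *)
Definition torsion_connection (s : R) i m (a b c : 'I_n) : R :=
  levi_civita i m a b c
  + 2 * s * \sum_d T i m a b d * metric_inv i m d c.

Definition char_connection := torsion_connection 4^-1.

(* (nabla_(d_a) T)(d_b, d_c, d_d) for the connection with symbols Gam. *)
Definition cov_form (Gam : chart A -> M -> 'I_n -> 'I_n -> 'I_n -> R)
    i m (a b c d : 'I_n) : R :=
  pd i a (fun x => T i x b c d) m
  - \sum_e (Gam i m a b e * T i m e c d + Gam i m a c e * T i m b e d
            + Gam i m a d e * T i m b c e).

Definition parallel_torsion : Prop :=
  forall i m a b c d, dom i m -> cov_form char_connection i m a b c d = 0.

End TangentConnections.

(* The size 2 ^ floor(n/2) forces the action of the complex Clifford algebra
   generated by the matrices to be irreducible, so that they define the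
   n-dimensional spinor module (either of the two if n is odd). *)
Record spinor_module (R : realType) (n : nat) :=
  SpinorModule {
    gamma :> 'I_n -> 'M[R[i]]_(2 ^ n./2);
    gamma_clifford : forall k l,
      gamma k *m gamma l + gamma l *m gamma k = ((- 2) *+ (k == l))%:M }.

Definition clifford_vec (R : realType) (n : nat) (G : spinor_module R n)
    (v : 'rV[R]_n) : 'M[R[i]]_(2 ^ n./2) :=
  \sum_k (v 0 k)%:C *: G k.

(* Spin(n): products of an even number of unit vectors of the Clifford algebra,
   identified with its image under the (faithful) spin representation. *)
Definition spin_group (R : realType) (n : nat) (G : spinor_module R n) :
    set 'M[R[i]]_(2 ^ n./2) :=
  [set u | exists vs : seq 'rV[R]_n,
     [/\ ~~ odd (size vs),
         (forall v, v \in vs -> v *m v^T = 1%:M)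
       & u = \big[mulmx/1%:M]_(v <- vs) clifford_vec G v]].

(* Over triv_dom t, the rows of frame t i m are the components in the chart i
   of an oriented orthonormal frame.  The frames of t and t' are related by
   e'_k = \sum_l B k l *: e_l with B = frame t' i m *m invmx (frame t i m), and
   u = lift t t' m covers this change of frame when
   u . E_k . u^-1 = \sum_l B k l *: E_l for the standard basis E of R^n. *)
Record spin_structure (R : realType) (n : nat) (M : topologicalType)
    (A : oriented_atlas R n M) (g : riemannian_metric A)
    (G : spinor_module R n) :=
  SpinStructure {
    triv : Type;
    triv_dom : triv -> set M;
    triv_open : forall t, open (triv_dom t);
    triv_cover : forall m, exists t, triv_dom t m;
    frame : triv -> chart A -> M -> 'M[R]_n;
    frame_smooth : forall t i k a,
      smooth_on A (triv_dom t `&` dom i) (fun m => frame t i m k a);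
    frame_tensorial : forall t i j m, triv_dom t m -> dom i m -> dom j m ->
      frame t j m = frame t i m *m jac i j m;
    frame_orthonormal : forall t i m, triv_dom t m -> dom i m ->
      frame t i m *m g i m *m (frame t i m)^T = 1%:M;
    frame_oriented : forall t i m, triv_dom t m -> dom i m ->
      0 < \det (frame t i m);
    lift : triv -> triv -> M -> 'M[R[i]]_(2 ^ n./2);
    lift_spin : forall t t' m, triv_dom t m -> triv_dom t' m ->
      spin_group G (lift t t' m);
    lift_smooth : forall t t' p q,
      smoothC_on A (triv_dom t `&` triv_dom t') (fun m => lift t t' m p q);
    lift_cocycle : forall t t' t'' m,
      triv_dom t m -> triv_dom t' m -> triv_dom t'' m ->
      lift t t' m *m lift t' t'' m = lift t t'' m;
    lift_covers : forall t t' i m k,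
      triv_dom t m -> triv_dom t' m -> dom i m ->
      lift t t' m *m G k =
      clifford_vec G (row k (frame t' i m *m invmx (frame t i m)))
        *m lift t t' m }.

(* Sections of the spinor bundle associated with the cocycle. *)
Record spinor_field (R : realType) (n : nat) (M : topologicalType)
    (A : oriented_atlas R n M) (g : riemannian_metric A)
    (G : spinor_module R n) (S : spin_structure g G) :=
  SpinorField {
    spinor :> triv S -> M -> 'cV[R[i]]_(2 ^ n./2);
    spinor_smooth : forall t p,
      smoothC_on A (triv_dom t) (fun m => spinor t m p 0);
    spinor_equivariant : forall t t' m, triv_dom t m -> triv_dom t' m ->
      spinor t m = lift t t' m *m spinor t' m }.

Definition zero_set (R : realType) (n : nat) (M : topologicalType)
    (A : oriented_atlas R n M) (g : riemannian_metric A)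
    (G : spinor_module R n) (S : spin_structure g G) (phi : spinor_field S) :
    set M :=
  [set m | forall t, triv_dom t m -> phi t m = 0].

(* All spinors below are expressed in the trivialization t, all tangent vectors
   X by their components in the chart i. *)
Section SpinorConnections.
Context (R : realType) (n : nat) (M : topologicalType).
Context (A : oriented_atlas R n M) (g : riemannian_metric A).
Context (G : spinor_module R n) (S : spin_structure g G).
Context (T : three_form A).
Implicit Types (t : triv S) (i : chart A) (m : M) (X : 'rV[R]_n).
Implicit Types (phi : spinor_field S).

(* e_k for the frame e of t. *)
Definition frame_vec t i m (k : 'I_n) : 'rV[R]_n := row k (frame t i m).

(* Clifford multiplication by X = \sum_k g(X, e_k) e_k. *)
Definition clifford_mul t i m X : 'M[R[i]]_(2 ^ n./2) :=
  clifford_vec G (X *m g i m *m (frame t i m)^T).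

(* nabla^g_X e_k. *)
Definition cov_frame t i m X (k : 'I_n) : 'rV[R]_n :=
  \row_c \sum_a X 0 a *
    (pd i a (fun x => frame t i x k c) m
     + \sum_b levi_civita g i m a b c * frame t i m k b).

(* nabla^g_X phi =
   X(phi) + 1/2 \sum_(k < l) g(nabla^g_X e_k, e_l) e_k.e_l.phi. *)
Definition nabla_g phi t i m X : 'cV[R[i]]_(2 ^ n./2) :=
  \sum_a (X 0 a)%:C *: (\col_p pdC i a (fun x => phi t x p 0) m)
  + 2^-1 *: \sum_(k < n) \sum_(l < n | (k < l)%N)
      ((cov_frame t i m X k *m g i m *m (frame_vec t i m l)^T) 0 0)%:C
        *: (G k *m G l *m phi t m).

Definition form_eval i m (X Y Z : 'rV[R]_n) : R :=
  \sum_a \sum_b \sum_c X 0 a * Y 0 b * Z 0 c * T i m a b c.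

(* Clifford multiplication by the 2-form T(X, -, -). *)
Definition clifford_contr t i m X : 'M[R[i]]_(2 ^ n./2) :=
  \sum_(k < n) \sum_(l < n | (k < l)%N)
    (form_eval i m X (frame_vec t i m k) (frame_vec t i m l))%:C
      *: (G k *m G l).

Definition nabla_s (s : R) phi t i m X : 'cV[R[i]]_(2 ^ n./2) :=
  nabla_g phi t i m X + s%:C *: (clifford_contr t i m X *m phi t m).

Definition dirac_s (s : R) phi t i m : 'cV[R[i]]_(2 ^ n./2) :=
  \sum_k clifford_mul t i m (frame_vec t i m k)
         *m nabla_s s phi t i m (frame_vec t i m k).

Definition twistor_spinor (s : R) phi : Prop :=
  forall t i m X, triv_dom t m -> dom i m ->
    nabla_s s phi t i m X
    + n%:R^-1 *: (clifford_mul t i m X *m dirac_s s phi t i m) = 0.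

End SpinorConnections.

(* Main.v *)
Require Import Defs.
From mathcomp Require Import all_boot all_order all_algebra.
From mathcomp Require Import complex ring lra.
From mathcomp Require Import all_classical all_reals all_analysis.
Import Order.TTheory GRing.Theory Num.Theory.
Import numFieldNormedType.Exports.
Local Open Scope classical_set_scope.
Local Open Scope ring_scope.

(** Write psi for D^s(phi) / n. In a local orthonormal frame the twistor equation
    reads X_k phi + Gamma_k phi + e_k . psi = 0, where X_k is the derivation along
    the k-th frame vector and the Gamma_k are smooth matrices. Two facts about a
    zero m of phi give the result.

    If psi(m) <> 0, the differential of phi at m is h |-> - h . psi(m). Clifford
    multiplication by h squares to -|h|^2, so this map is bounded below, and phi has
    no other zero near m (isolated_near).

    If psi(m) = 0, then phi vanishes near m (vanish_near). Differentiating the k-th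
    equation along X_l, antisymmetrising in k and l and cancelling the second
    derivatives of phi (curvature_identity) leaves
    e_k . X_l psi - e_l . X_k psi = terms linear in phi and its first derivatives,
    hence in phi and psi. With c_k = e_k . X_k psi this determines every sum
    c_k + c_l with k <> l, so for n >= 3 it determines every c_k
    (clifford_antisym_solve). Therefore all first derivatives of (phi, psi) are
    bounded by a constant times the size of (phi, psi), and such a family vanishes
    near each point where it is zero (vanish_of_dominated).

    So every zero of phi is isolated or interior to the zero set (zero_dichotomy),
    and the interior of the zero set is closed. On a connected manifold a non-zero
    phi has an empty interior of its zero set, and all zeros are isolated.

    The analysis is done for real matrices in coordinates: spinors become stacks of
    real and imaginary parts (real_vec), and the coefficients of the equation are
    continuously differentiable functions on an open set of R^n. *)

Set Implicit Arguments.
Unset Strict Implicit.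
Unset Printing Implicit Defensive.

(** * Neighbourhoods *)

Lemma near_forall (I : finType) (T : topologicalType) (x : T)
    (P : I -> T -> Prop) :
  (forall i, \forall y \near x, P i y) -> \forall y \near x, forall i, P i y.
Proof. by move=> H; exact: filter_forall. Qed.

Lemma near_boxP (R : realType) (n : nat) (x : 'rV[R]_n) (P : 'rV[R]_n -> Prop) :
  (\forall y \near x, P y) <->
  exists2 r, 0 < r & forall y, `|y - x| < r -> P y.
Proof.
split=> [/nbhs_normP[r r0 H]|[r r0 H]].
  by exists r => // y yr; apply: H; rewrite /ball_ /= distrC.
by apply/nbhs_normP; exists r => // y; rewrite /ball_ /= distrC; exact: H.
Qed.

Lemma near_and (T : topologicalType) (x : T) (P Q : T -> Prop) :
  (\forall y \near x, P y) -> (\forall y \near x, Q y) ->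
  \forall y \near x, P y /\ Q y.
Proof. exact: filterI. Qed.

Lemma near_open (T : topologicalType) (U : set T) x :
  open U -> U x -> \forall y \near x, U y.
Proof. by move=> oU Ux; exact: open_nbhs_nbhs. Qed.

Lemma continuous_near_eq (T U : topologicalType) (f g : T -> U) x :
  (\forall y \near x, f y = g y) ->
  {for x, continuous f} -> {for x, continuous g}.
Proof.
move=> fg cf; have fgx : f x = g x := nbhs_singleton fg.
rewrite /prop_for /continuous_at -fgx; apply: cvg_trans cf.
exact: near_eq_cvg.
Qed.

(** * Mean values and mixed partial derivatives *)

Section PartialDerivatives.
Context {R : realType} {n : nat}.
Implicit Types (f : 'rV[R]_n -> R) (x y v : 'rV[R]_n) (r : R) (a b : 'I_n).

Local Notation axis a := (delta_mx 0 a : 'rV[R]_n).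

Lemma distr_half_le (p q z e : R) :
  `|p - z| < e / 2 -> `|q - z| < e / 2 -> `|p - q| <= e.
Proof.
move=> pz qz; rewrite (splitr e) -(subrKA z) (le_trans (ler_normD _ _)) //.
by rewrite ltW // ltrD // distrC.
Qed.

Lemma is_derive_line f x v (u : R) : derivable f (x + u *: v) v ->
  is_derive u 1 (fun u => f (x + u *: v)) ('D_v f (x + u *: v)).
Proof.
move=> df.
have E : (fun h : R => h^-1 *: (((fun u => f (x + u *: v)) \o shift u) (h *: 1)
    - f (x + u *: v))) =
  (fun h : R => h^-1 *: ((f \o shift (x + u *: v)) (h *: v) - f (x + u *: v))).
  apply/funext => h /=; congr (_ *: (f _ - _)).
  by rewrite [h *: 1]mulr1 scalerDl addrCA.
by split; rewrite /derivable /derive E.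
Qed.

(** The parameter u ranges over [-|t|, |t|] rather than between 0 and t, which
    avoids a case distinction on the sign of t in applications. *)
Lemma mvt_line f x v (t : R) :
    (forall u, `|u| <= `|t| -> derivable f (x + u *: v) v) ->
  exists2 u, `|u| <= `|t| & f (x + t *: v) - f x = t * 'D_v f (x + u *: v).
Proof.
move=> df; pose h (u : R) : R := f (x + u *: v).
have hd (u : R) : `|u| <= `|t| -> is_derive u 1 h ('D_v f (x + u *: v)).
  by move=> /df; exact: is_derive_line.
have h0 : h 0 = f x by rewrite /h scale0r addr0.
have [t0|t0] := leP 0 t.
- have I u : u \in `[0, t] -> `|u| <= `|t|.
    by rewrite in_itv /= => /andP[u0 ut]; rewrite (ger0_norm t0) (ger0_norm u0).
  have J u : u \in `]0, t[ -> `|u| <= `|t|.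
    rewrite in_itv /= => /andP[u0 ut].
    by rewrite (ger0_norm t0) (ger0_norm (ltW u0)) ltW.
  have [|u /I ut E] := MVT_segment t0 (fun u ut => hd u (J _ ut)).
    by apply: derivable_within_continuous => u /I /hd [].
  by exists u => //; rewrite -h0 -/(h t) E subr0 mulrC.
- have I u : u \in `[t, 0] -> `|u| <= `|t|.
    rewrite in_itv /= => /andP[u0 ut].
    by rewrite (ler0_norm (ltW t0)) (ler0_norm ut) lerN2.
  have J u : u \in `]t, 0[ -> `|u| <= `|t|.
    rewrite in_itv /= => /andP[u0 ut].
    by rewrite (ler0_norm (ltW t0)) (ler0_norm (ltW ut)) lerN2 ltW.
  have [|u /I ut E] := MVT_segment (ltW t0) (fun u ut => hd u (J _ ut)).
    by apply: derivable_within_continuous => u /I /hd [].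
  exists u => //; rewrite -h0 -/(h t) -opprB E sub0r mulrN opprK mulrC //.
Qed.

Lemma rv_norm_leP (v : 'rV[R]_n) (r : R) : 0 <= r ->
  reflect (forall j, `|v 0 j| <= r) (`|v| <= r).
Proof.
move=> r0; rewrite [leLHS]/Num.Def.normr /= mx_normrE.
apply: (iffP (bigmax_leP _ _ _ _)) => [[_ H] j|H]; first exact: (H (0, j)).
by split=> // -[i j] _; rewrite /= (ord1 i).
Qed.

(** Moving one coordinate at a time keeps the path inside a ball for the
    maximum norm, so that partial derivatives suffice. *)
Lemma mvt_box f x0 r x :
    (forall y a, `|y - x0| < r -> derivable f y (axis a)) -> `|x - x0| < r ->
  exists2 z : 'I_n -> 'rV[R]_n, (forall a, `|z a - x0| <= `|x - x0|) &
    f x - f x0 = \sum_a (x 0 a - x0 0 a) * 'D_(axis a) f (z a).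
Proof.
move=> df xr.
pose p k : 'rV[R]_n := \row_j if (j < k)%N then x 0 j else x0 0 j.
have nx j : `|x 0 j - x0 0 j| <= `|x - x0|.
  by have /(rv_norm_leP _ (normr_ge0 _))/(_ j) := lexx `|x - x0|; rewrite !mxE.
have inbox (a : 'I_n) u : `|u| <= `|x 0 a - x0 0 a| ->
    `|p a + u *: axis a - x0| <= `|x - x0|.
  move=> hu; apply/(rv_norm_leP _ (normr_ge0 _)) => j; rewrite !mxE eqxx /=.
  have [->|ja] := eqVneq j a.
    by rewrite ltnn mulr1 addrAC subrr add0r (le_trans hu).
  by rewrite mulr0 addr0; case: ifP => // _; rewrite subrr normr0.
have step (a : 'I_n) : exists y, `|y - x0| <= `|x - x0| /\
    f (p a.+1) - f (p a) = (x 0 a - x0 0 a) * 'D_(axis a) f y.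
  have E : p a.+1 = p a + (x 0 a - x0 0 a) *: axis a.
    apply/rowP => j; rewrite !mxE eqxx /=.
    have [->|ja] := eqVneq j a; first by rewrite ltnSn ltnn mulr1 subrKC.
    by rewrite mulr0 addr0 ltnS leq_eqVlt (negbTE ja : (_ == _ :> nat) = _).
  have [u hu Eu] := @mvt_line f (p a) (axis a) (x 0 a - x0 0 a)
    (fun u hu => df _ a (le_lt_trans (inbox a u hu) xr)).
  by exists (p a + u *: axis a); split; [exact: inbox | rewrite E Eu].
have [z hz] := choice step; exists z => [a|]; first by case: (hz a).
have -> : f x - f x0 = \sum_(0 <= k < n) (f (p k.+1) - f (p k)).
  rewrite telescope_sumr //; congr (f _ - f _); apply/rowP => j.
    by rewrite mxE ltn_ord.
  by rewrite mxE ltn0.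
by rewrite big_mkord; apply: eq_bigr => a _; case: (hz a).
Qed.

(** The difference y |-> f (y + h e_b) - f y is expanded along e_a first, and its
    derivative, a difference of values of the a-th partial, along e_b. *)
Lemma second_difference f x0 r a b :
    (forall y, `|y - x0| < r -> derivable f y (axis a) /\
       derivable ('D_(axis a) f) y (axis b)) ->
  forall h : R, `|h| + `|h| < r -> exists2 y, `|y - x0| <= `|h| + `|h| &
    f (x0 + h *: axis a + h *: axis b) - f (x0 + h *: axis a)
    - (f (x0 + h *: axis b) - f x0) = h * (h * 'D_(axis b) ('D_(axis a) f) y).
Proof.
move=> df h hr.
have axis1 c : `|axis c| <= 1.
  apply/rv_norm_leP => // j; rewrite mxE eqxx /=; case: eqP => _ //.
    by rewrite normr1.
  by rewrite normr0.
have small u w : `|u| <= `|h| -> `|w| <= `|h| ->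
    `|x0 + u *: axis a + w *: axis b - x0| <= `|h| + `|h|.
  move=> hu hw; rewrite addrAC [x0 + _]addrC addrK.
  rewrite (le_trans (ler_normD _ _)) // lerD // normrZ.
    by rewrite (le_trans (ler_piMr _ (axis1 a))).
  by rewrite (le_trans (ler_piMr _ (axis1 b))).
pose G y := f (y + h *: axis b) - f y.
have dG u : `|u| <= `|h| -> is_derive (x0 + u *: axis a) (axis a) G
    ('D_(axis a) f (x0 + u *: axis a + h *: axis b)
     - 'D_(axis a) f (x0 + u *: axis a)).
  move=> hu; apply: is_deriveB; last first.
    apply: derivableP; have [] // := df (x0 + u *: axis a).
    have := small u 0 hu; rewrite scale0r addr0 normr0 => /(_ (normr_ge0 _)) H.
    exact: le_lt_trans hr.
  have [d _] := df _ (le_lt_trans (small u h hu (lexx _)) hr).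
  have E : (fun k : R => k^-1 *: (((fun y => f (y + h *: axis b)) \o
      shift (x0 + u *: axis a)) (k *: axis a)
    - f (x0 + u *: axis a + h *: axis b))) =
   (fun k : R => k^-1 *: ((f \o shift (x0 + u *: axis a + h *: axis b))
      (k *: axis a) - f (x0 + u *: axis a + h *: axis b))).
    by apply/funext => k /=; rewrite !addrA.
  by split; rewrite /derivable /derive E.
have [u hu Eu] := @mvt_line G x0 (axis a) h
  (fun u hu => @ex_derive _ _ _ _ _ _ _ (dG u hu)).
have [w hw Ew] := @mvt_line ('D_(axis a) f) (x0 + u *: axis a) (axis b) h
  (fun w hw => (df _ (le_lt_trans (small u w hu hw) hr)).2).
exists (x0 + u *: axis a + w *: axis b); first exact: small.
by rewrite -/(G _) -/(G _) Eu (@derive_val _ _ _ _ _ _ _ (dG u hu)) Ew.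
Qed.

(** Schwarz's theorem. For each small h, the second difference of f equals h^2
    times either mixed derivative at some point within 2 h of x0, and both mixed
    derivatives are continuous there. *)
Lemma derive_comm f x0 a b :
    (\forall y \near x0, [/\ derivable f y (axis a), derivable f y (axis b),
      derivable ('D_(axis a) f) y (axis b) &
      derivable ('D_(axis b) f) y (axis a)]) ->
    {for x0, continuous ('D_(axis b) ('D_(axis a) f))} ->
    {for x0, continuous ('D_(axis a) ('D_(axis b) f))} ->
  'D_(axis b) ('D_(axis a) f) x0 = 'D_(axis a) ('D_(axis b) f) x0.
Proof.
move=> /near_boxP[r r0 dfb] cab cba.
apply/eqP; rewrite -subr_eq0 -normr_le0; apply/ler_addgt0Pr => e e0.
have e2 : 0 < e / 2 by rewrite divr_gt0.
have near_ab : \forall y \near x0,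
    `|'D_(axis b) ('D_(axis a) f) x0 - 'D_(axis b) ('D_(axis a) f) y| < e / 2 /\
    `|'D_(axis a) ('D_(axis b) f) x0 - 'D_(axis a) ('D_(axis b) f) y| < e / 2.
  by apply: filterI; [move/cvgrPdist_lt: cab | move/cvgrPdist_lt: cba]; apply.
move: near_ab => /near_boxP[rho rho0 hrho].
pose h := Num.min r rho / 3.
have h0 : 0 < h by rewrite divr_gt0 // lt_min r0 rho0.
have hh : `|h| + `|h| < Num.min r rho.
  rewrite gtr0_norm // /h; set m := Num.min r rho.
  have m0 : 0 < m by rewrite lt_min r0 rho0.
  lra.
have [hr hrho'] : `|h| + `|h| < r /\ `|h| + `|h| < rho.
  by move: hh; rewrite lt_min => /andP[].
have [y yh Ey] := second_difference (a := a) (b := b)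
  (fun y hy => let: And4 p _ q _ := dfb y hy in conj p q) hr.
have [z zh Ez] := second_difference (a := b) (b := a)
  (fun y hy => let: And4 _ p _ q := dfb y hy in conj p q) hr.
have E : 'D_(axis b) ('D_(axis a) f) y = 'D_(axis a) ('D_(axis b) f) z.
  apply: (mulfI (lt0r_neq0 h0)); apply: (mulfI (lt0r_neq0 h0)).
  have comm : x0 + h *: axis b + h *: axis a = x0 + h *: axis a + h *: axis b.
    exact: addrAC.
  apply: etrans (esym Ey) _; apply: etrans _ Ez; rewrite comm.
  set p := f (_ + _ + _); set q := f (_ + h *: axis a).
  set p' := f (_ + h *: axis b).
  by ring.
have [Hy _] := hrho y (le_lt_trans yh hrho').
have [_ Hz] := hrho z (le_lt_trans zh hrho').
rewrite add0r; apply: (distr_half_le Hy); rewrite E; exact: Hz.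
Qed.
End PartialDerivatives.

Local Notation axis a := (delta_mx 0 a : 'rV[_]__).

(** * Families of functions that dominate their own derivatives *)

Section Vanishing.
Context {R : realType} {n : nat} {I : finType} (u : I -> 'rV[R]_n -> R).
Variable x0 : 'rV[R]_n.
Let w y := \sum_i `|u i y|.

Lemma total_size_ge0 y : 0 <= w y.
Proof. by apply: sumr_ge0. Qed.

(** On a box of radius r the mean value theorem bounds the total size w by r q
    times its own supremum there. The radius is chosen with r q <= 1/2, and a
    supremum bounded by half of itself is zero. *)
Lemma vanish_of_dominated :
    (\forall y \near x0, forall i a, derivable (u i) y (axis a)) ->
    (forall i, {for x0, continuous (u i)}) ->
    (forall i a, exists C, \forall y \near x0,
       `|'D_(axis a) (u i) y| <= C * w y) ->
    (forall i, u i x0 = 0) ->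
  \forall y \near x0, forall i, u i y = 0.
Proof.
move=> du cu bd u0.
have [C hC] := choice (fun ia : I * 'I_n => bd ia.1 ia.2).
pose K := 1 + \sum_ia `|C ia|.
have K0 : 0 < K by rewrite ltr_pwDl // sumr_ge0.
have near_bd : \forall y \near x0, forall ia : I * 'I_n,
    `|'D_(axis ia.2) (u ia.1) y| <= K * w y.
  apply: near_forall => ia; apply: filterS (hC ia) => y /le_trans; apply.
  rewrite ler_wpM2r ?total_size_ge0 // (le_trans (ler_norm _)) //.
  rewrite /K (bigD1 ia) //= addrA [1 + _]addrC -addrA lerDl.
  by rewrite addr_ge0 // sumr_ge0.
have near_1 : \forall y \near x0, forall i : I, `|u i y| <= 1.
  apply: near_forall => i.
  have /cvgrPdist_le /(_ _ ltr01) := cu i.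
  by apply: filterS => y; rewrite u0 sub0r normrN.
have /near_boxP[r1 r10 hr1] := near_and du (near_and near_bd near_1).
pose q : R := n%:R * #|I|%:R * K.
have q0 : 0 <= q by rewrite !mulr_ge0 // ltW.
pose r := Num.min r1 (2 * (q + 1))^-1.
have r0 : 0 < r by rewrite lt_min r10 invr_gt0 mulr_gt0 // ltr_wpDl.
have rr1 : r <= r1 by rewrite ge_min lexx.
have rq : r * q <= 2^-1.
  apply: le_trans (_ : (2 * (q + 1))^-1 * q <= _).
    by rewrite ler_wpM2r // ge_min lexx orbT.
  rewrite invfM -mulrA ler_piMr // ler_pdivrMl ?mulr1 ?lerDl //.
  by rewrite ltr_wpDl.
have inball y : `|y - x0| < r -> `|y - x0| < r1 by move/lt_le_trans; exact.
have halve B : (forall y, `|y - x0| < r -> w y <= B) ->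
    forall y, `|y - x0| < r -> w y <= B / 2.
  move=> wB y yr.
  have B0 : 0 <= B by apply: le_trans (wB y yr); exact: total_size_ge0.
  have each i : `|u i y| <= r * (n%:R * K) * B.
    have [z hz E] := @mvt_box R n (u i) x0 r y
      (fun z a hz => (hr1 z (inball z hz)).1 i a) yr.
    rewrite -[u i y]subr0 -(u0 i) E (le_trans (ler_norm_sum _ _ _)) //.
    apply: (@le_trans _ _ (\sum_(a < n) r * (K * B))); last first.
      rewrite sumr_const card_ord -mulr_natl le_eqVlt; apply/orP; left.
      by apply/eqP; ring.
    apply: ler_sum => a _; rewrite normrM ler_pM //.
      have /rv_norm_leP : `|y - x0| <= r by exact: ltW.
      by move=> /(_ (ltW r0) a); rewrite !mxE.
    have za : `|z a - x0| < r by exact: le_lt_trans (hz a) yr.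
    have [_ [/(_ (i, a)) /= H _]] := hr1 (z a) (inball _ za).
    by rewrite (le_trans H) // ler_wpM2l ?wB // ltW.
  apply: le_trans (ler_sum _ (fun i _ => each i)) _.
  have -> : \sum_(i : I) r * (n%:R * K) * B = r * q * B.
    by rewrite sumr_const (@eq_card I _ I) // -[LHS]mulr_natl /q; ring.
  by rewrite (mulrC B) ler_wpM2r.
have bounded y : `|y - x0| < r -> w y <= #|I|%:R.
  move=> yr; have [_ [_ H]] := hr1 y (inball _ yr).
  apply: le_trans (ler_sum _ (fun i _ => H i)) _.
  by rewrite sumr_const.
pose W := w @` [set y | `|y - x0| < r].
have supW : has_sup W.
  split; first by exists (w x0); exists x0; rewrite //= subrr normr0.
  by exists #|I|%:R => _ [y yr <-]; exact: bounded.
have wsup y : `|y - x0| < r -> w y <= sup W.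
  by move=> yr; apply: sup_upper_bound => //; exists y.
have sup0 : sup W <= 0.
  have : sup W <= sup W / 2.
    by apply: ge_sup; [exact: supW.1 | move=> _ [y yr <-]; exact: halve wsup y yr].
  lra.
apply/near_boxP; exists r => // y yr i.
have := le_trans (wsup y yr) sup0; rewrite /w (bigD1 i) //= => H.
apply/eqP; rewrite -normr_le0; apply: le_trans H; rewrite lerDl.
by apply: sumr_ge0.
Qed.
End Vanishing.

(** * Continuously differentiable functions and matrices *)

Section C1.
Context {R : realType} {n : nat}.
Variable U : set 'rV[R]_n.
Hypothesis oU : open U.
Implicit Types f g : 'rV[R]_n -> R.

Definition C1 f := forall x, U x -> {for x, continuous f} /\
  forall a, derivable f x (axis a) /\ {for x, continuous ('D_(axis a) f)}.

Lemma C1_eq f g : (forall x, U x -> f x = g x) -> C1 f -> C1 g.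
Proof.
move=> fg c1 x Ux; have [cf df] := c1 x Ux.
have nfg : \forall y \near x, f y = g y.
  by apply: filterS (near_open oU Ux) => y; exact: fg.
split=> [|a]; first exact: continuous_near_eq cf.
have [d c] := df a; split; first exact: near_eq_derivable d.
apply: continuous_near_eq c; apply: filterS (near_open oU Ux) => y Uy.
by apply: near_eq_derive; apply: filterS (near_open oU Uy) => z; exact: fg.
Qed.

Lemma C1_cst (c : R) : C1 (fun=> c).
Proof.
move=> x Ux; split=> [|a]; first exact: cst_continuous.
split; first exact: derivable_cst.
rewrite (_ : 'D_(axis a) (fun=> c) = fun=> 0); first exact: cst_continuous.
by apply/funext => y; rewrite derive_cst.
Qed.

Lemma C1D f g : C1 f -> C1 g -> C1 (fun x => f x + g x).
Proof.
move=> c1f c1g x Ux; have [cf df] := c1f x Ux; have [cg dg] := c1g x Ux.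
split=> [|a]; first exact: (cvgD cf cg).
have [[d c] [d' c']] := (df a, dg a); split; first exact: (derivableD d d').
apply: (@continuous_near_eq _ _ (fun y => 'D_(axis a) f y + 'D_(axis a) g y)).
  apply: filterS (near_open oU Ux) => y Uy; apply/esym; apply: deriveD.
    by case: (c1f y Uy) => _ /(_ a)[].
  by case: (c1g y Uy) => _ /(_ a)[].
exact: (cvgD c c').
Qed.

Lemma C1M f g : C1 f -> C1 g -> C1 (fun x => f x * g x).
Proof.
move=> c1f c1g x Ux; have [cf df] := c1f x Ux; have [cg dg] := c1g x Ux.
split=> [|a]; first exact: (cvgM cf cg).
have [[d c] [d' c']] := (df a, dg a); split; first exact: (derivableM d d').
apply: (@continuous_near_eq _ _
  (fun y => f y * 'D_(axis a) g y + g y * 'D_(axis a) f y)).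
  apply: filterS (near_open oU Ux) => y Uy; apply/esym; apply: deriveM.
    by case: (c1f y Uy) => _ /(_ a)[].
  by case: (c1g y Uy) => _ /(_ a)[].
exact: (cvgD (cvgM cf c') (cvgM cg c)).
Qed.

Lemma C1N f : C1 f -> C1 (fun x => - f x).
Proof.
move=> c1f; apply: (@C1_eq (fun x => -1 * f x)); last exact: C1M (C1_cst _) c1f.
by move=> x _; rewrite mulN1r.
Qed.

Lemma C1_sum I (r : seq I) (P : pred I) (f : I -> 'rV[R]_n -> R) :
  (forall i, P i -> C1 (f i)) -> C1 (fun x => \sum_(i <- r | P i) f i x).
Proof.
move=> c1f; elim: r => [|i r IH].
  by apply: C1_eq (C1_cst 0) => x _; rewrite big_nil.
have [Pi|nPi] := boolP (P i).
  by apply: C1_eq (C1D (c1f i Pi) IH) => x _; rewrite big_cons Pi.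
by apply: C1_eq IH => x _; rewrite big_cons (negbTE nPi).
Qed.

Lemma C1_derive f x a : C1 f -> U x ->
  is_derive x (axis a) f ('D_(axis a) f x).
Proof. by move=> c1f /c1f[_ /(_ a)[d _]]; exact: derivableP. Qed.

Lemma C1_continuous f x : C1 f -> U x -> {for x, continuous f}.
Proof. by move=> c1f /c1f[]. Qed.

Lemma C1_derive_continuous f x a : C1 f -> U x ->
  {for x, continuous ('D_(axis a) f)}.
Proof. by move=> c1f /c1f[_ /(_ a)[]]. Qed.
End C1.

Section MatrixDerivative.
Context {R : realType} {n : nat}.
Variables (x : 'rV[R]_n) (a : 'I_n).

Definition partial_mx p q (F : 'rV[R]_n -> 'M[R]_(p, q)) (y : 'rV[R]_n) :
    'M[R]_(p, q) :=
  \matrix_(i, j) 'D_(axis a) (fun z => F z i j) y.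

Definition is_partial_mx p q (F : 'rV[R]_n -> 'M[R]_(p, q)) (dF : 'M[R]_(p, q)) :=
  forall i j, is_derive x (axis a) (fun y => F y i j) (dF i j).

Lemma is_partial_mxD p q (F G : 'rV[R]_n -> 'M[R]_(p, q)) dF dG :
  is_partial_mx F dF -> is_partial_mx G dG ->
  is_partial_mx (fun y => F y + G y) (dF + dG).
Proof.
move=> hF hG i j; rewrite mxE.
under [fun y => _]eq_fun do rewrite mxE.
exact: is_deriveD.
Qed.

Lemma is_partial_mx_sum p q I (r : seq I) (F : I -> 'rV[R]_n -> 'M[R]_(p, q)) dF :
  (forall k, is_partial_mx (F k) (dF k)) ->
  is_partial_mx (fun y => \sum_(k <- r) F k y) (\sum_(k <- r) dF k).
Proof.
move=> hF; elim: r => [|k r IH].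
  rewrite big_nil; under [fun y => _]eq_fun do rewrite big_nil.
  by move=> i j; rewrite !mxE; exact: is_derive_cst.
rewrite big_cons; under [fun y => _]eq_fun do rewrite big_cons.
exact: is_partial_mxD.
Qed.

Lemma is_derive_sum_seq I (r : seq I) (f : I -> 'rV[R]_n -> R) df :
  (forall k, is_derive x (axis a) (f k) (df k)) ->
  is_derive x (axis a) (fun y => \sum_(k <- r) f k y) (\sum_(k <- r) df k).
Proof.
move=> hf; elim: r => [|k r IH].
  rewrite big_nil; under [fun y => _]eq_fun do rewrite big_nil.
  exact: is_derive_cst.
rewrite big_cons; under [fun y => _]eq_fun do rewrite big_cons.
exact: is_deriveD.
Qed.

Lemma is_partial_mxM p q r (F : 'rV[R]_n -> 'M[R]_(p, q)) (G : 'rV[R]_n -> 'M[R]_(q, r))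
    dF dG :
  is_partial_mx F dF -> is_partial_mx G dG ->
  is_partial_mx (fun y => F y *m G y) (dF *m G x + F x *m dG).
Proof.
move=> hF hG i j.
rewrite !mxE -big_split /=; under [fun y => _]eq_fun do rewrite mxE.
apply: is_derive_sum_seq => k.
apply: (is_derive_eq (is_deriveM (hF i k) (hG k j))).
by rewrite addrC /GRing.scale /= [G x k j * _]mulrC.
Qed.

Lemma is_partial_mxZ p q (c : 'rV[R]_n -> R) (F : 'rV[R]_n -> 'M[R]_(p, q)) dc dF :
  is_derive x (axis a) c dc -> is_partial_mx F dF ->
  is_partial_mx (fun y => c y *: F y) (dc *: F x + c x *: dF).
Proof.
move=> hc hF i j.
rewrite !mxE; under [fun y => _]eq_fun do rewrite mxE.
apply: (is_derive_eq (is_deriveM hc (hF i j))).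
by rewrite addrC /GRing.scale /= [F x i j * _]mulrC.
Qed.

Lemma is_partial_mxMl p q r (H : 'M[R]_(p, q)) (F : 'rV[R]_n -> 'M[R]_(q, r)) dF :
  is_partial_mx F dF -> is_partial_mx (fun y => H *m F y) (H *m dF).
Proof.
move=> hF; have h0 : is_partial_mx (fun=> H) 0.
  by move=> i j; rewrite mxE; exact: is_derive_cst.
by have := is_partial_mxM h0 hF; rewrite mul0mx add0r.
Qed.

(** The form in which an identity on an open set is differentiated. *)
Lemma is_partial_mx_zero p q (F : 'rV[R]_n -> 'M[R]_(p, q)) dF :
  (\forall y \near x, F y = 0) -> is_partial_mx F dF -> dF = 0.
Proof.
move=> F0 hF; apply/matrixP => i j; rewrite mxE.
have nF : \forall y \near x, (fun=> 0) y = F y i j.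
  by apply: filterS F0 => y ->; rewrite mxE.
have [_ <-] := hF i j.
by rewrite -(near_eq_derive _ nF) derive_cst.
Qed.
End MatrixDerivative.

Section C1mx.
Context {R : realType} {n : nat}.
Variable U : set 'rV[R]_n.
Hypothesis oU : open U.

Definition C1mx p q (F : 'rV[R]_n -> 'M[R]_(p, q)) :=
  forall i j, C1 U (fun y => F y i j).

Lemma C1mx_partial p q (F : 'rV[R]_n -> 'M[R]_(p, q)) x a :
  C1mx F -> U x -> is_partial_mx x a F (partial_mx a F x).
Proof. by move=> c1 Ux i j; rewrite mxE; exact: C1_derive. Qed.

Lemma C1mxD p q (F G : 'rV[R]_n -> 'M[R]_(p, q)) :
  C1mx F -> C1mx G -> C1mx (fun y => F y + G y).
Proof.
move=> hF hG i j; apply: C1_eq (C1D oU (hF i j) (hG i j)) => // y _.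
by rewrite mxE.
Qed.

Lemma C1mxM p q r (F : 'rV[R]_n -> 'M[R]_(p, q)) (G : 'rV[R]_n -> 'M[R]_(q, r)) :
  C1mx F -> C1mx G -> C1mx (fun y => F y *m G y).
Proof.
move=> hF hG i j; apply: (C1_eq oU (f := fun y => \sum_k F y i k * G y k j)).
  by move=> y _; rewrite mxE.
by apply: (C1_sum oU) => k _; exact: C1M.
Qed.

Lemma C1mxZ p q (c : 'rV[R]_n -> R) (F : 'rV[R]_n -> 'M[R]_(p, q)) :
  C1 U c -> C1mx F -> C1mx (fun y => c y *: F y).
Proof.
move=> hc hF i j; apply: C1_eq (C1M oU hc (hF i j)) => // y _.
by rewrite mxE.
Qed.

Lemma C1mx_cst p q (H : 'M[R]_(p, q)) : C1mx (fun=> H).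
Proof. by move=> i j; exact: C1_cst. Qed.

Lemma C1mx_sum p q I (r : seq I) (P : pred I)
    (F : I -> 'rV[R]_n -> 'M[R]_(p, q)) :
  (forall k, P k -> C1mx (F k)) -> C1mx (fun y => \sum_(k <- r | P k) F k y).
Proof.
move=> hF i j; apply: (C1_eq oU (f := fun y => \sum_(k <- r | P k) F k y i j)).
  by move=> y _; rewrite summxE.
by apply: (C1_sum oU) => k Pk; exact: hF.
Qed.
End C1mx.

(** * Domination near a point *)

Section Domination.
Context {T : topologicalType} {R : realType}.
Variables (x0 : T) (w : T -> R).

(** The relation f = O(w) at x0, which is stable under products with functions
    continuous at x0. *)
Definition dominated (f : T -> R) :=
  exists C, \forall y \near x0, `|f y| <= C * w y.

Lemma dominated_eq f g :
  (\forall y \near x0, f y = g y) -> dominated f -> dominated g.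
Proof.
move=> fg [C hC]; exists C; apply: filterS (near_and fg hC) => y [<-]; exact.
Qed.

Lemma dominated0 : dominated (fun=> 0).
Proof. by exists 0; apply: filterE => y; rewrite normr0 mul0r. Qed.

Lemma dominatedD f g :
  dominated f -> dominated g -> dominated (fun y => f y + g y).
Proof.
move=> [C hC] [D hD]; exists (C + D).
apply: filterS (near_and hC hD) => y [h1 h2].
by rewrite mulrDl (le_trans (ler_normD _ _)) // lerD.
Qed.

Lemma dominatedM (c f : T -> R) :
  {for x0, continuous c} -> dominated f -> dominated (fun y => c y * f y).
Proof.
move=> cc [C hC]; exists ((`|c x0| + 1) * C).
move/cvgrPdist_le: cc => /(_ _ ltr01) cc.
apply: filterS (near_and cc hC) => y [h1 h2].
rewrite normrM -mulrA ler_pM //.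
rewrite -lerBlDl (le_trans _ h1) // distrC; exact: lerB_dist.
Qed.

Definition dominated_mx p q (F : T -> 'M[R]_(p, q)) :=
  forall i j, dominated (fun y => F y i j).

Definition continuous_mx p q (F : T -> 'M[R]_(p, q)) :=
  forall i j, {for x0, continuous (fun y => F y i j)}.

Lemma dominated_mx_eq p q (F G : T -> 'M[R]_(p, q)) :
  (\forall y \near x0, F y = G y) -> dominated_mx F -> dominated_mx G.
Proof.
by move=> FG hF i j; apply: dominated_eq (hF i j); apply: filterS FG => y ->.
Qed.

Lemma dominated_sum I (r : seq I) (f : I -> T -> R) :
  (forall k, dominated (f k)) -> dominated (fun y => \sum_(k <- r) f k y).
Proof.
move=> hf; elim: r => [|k r IH].
  by under [fun y => _]eq_fun do rewrite big_nil; exact: dominated0.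
by under [fun y => _]eq_fun do rewrite big_cons; exact: dominatedD.
Qed.

Lemma dominated_mxD p q (F G : T -> 'M[R]_(p, q)) :
  dominated_mx F -> dominated_mx G -> dominated_mx (fun y => F y + G y).
Proof.
move=> hF hG i j; under [fun y => _]eq_fun do rewrite mxE.
exact: dominatedD.
Qed.

Lemma dominated_mxZ p q (c : T -> R) (F : T -> 'M[R]_(p, q)) :
  {for x0, continuous c} -> dominated_mx F ->
  dominated_mx (fun y => c y *: F y).
Proof.
move=> hc hF i j; under [fun y => _]eq_fun do rewrite mxE.
exact: dominatedM.
Qed.

Lemma dominated_mxN p q (F : T -> 'M[R]_(p, q)) :
  dominated_mx F -> dominated_mx (fun y => - F y).
Proof.
move=> hF; under [fun y => _]eq_fun do rewrite -scaleN1r.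
apply: dominated_mxZ => //; exact: cst_continuous.
Qed.

Lemma dominated_mx_sum p q I (r : seq I) (F : I -> T -> 'M[R]_(p, q)) :
  (forall k, dominated_mx (F k)) ->
  dominated_mx (fun y => \sum_(k <- r) F k y).
Proof.
move=> hF i j; under [fun y => _]eq_fun do rewrite summxE.
by apply: dominated_sum => k; exact: hF.
Qed.

Lemma dominated_mxM p q r (A : T -> 'M[R]_(p, q)) (F : T -> 'M[R]_(q, r)) :
  continuous_mx A -> dominated_mx F -> dominated_mx (fun y => A y *m F y).
Proof.
move=> hA hF i j; under [fun y => _]eq_fun do rewrite mxE.
by apply: dominated_sum => k; exact: dominatedM.
Qed.

Lemma dominated_mxMl p q r (A : 'M[R]_(p, q)) (F : T -> 'M[R]_(q, r)) :
  dominated_mx F -> dominated_mx (fun y => A *m F y).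
Proof. by apply: dominated_mxM => i j; exact: cst_continuous. Qed.
End Domination.

(** * Clifford families *)

Definition clifford_family (R : pzRingType) n N (H : 'I_n -> 'M[R]_N) :=
  forall k l, H k *m H l + H l *m H k = ((- 2) *+ (k == l))%:M.

Section Clifford.
Context {R : numFieldType} {n N : nat}.
Variable H : 'I_n -> 'M[R]_N.
Hypothesis cl : clifford_family H.

Lemma clifford_sqr k : H k *m H k = - 1%:M.
Proof.
have two0 : (2 : R) != 0 by rewrite pnatr_eq0.
apply: (scalerI two0); rewrite scaler_nat mulr2n cl eqxx mulr1n.
by rewrite scalerN scalemx1 raddfN.
Qed.

Lemma clifford_anti k l : k != l -> H k *m H l = - (H l *m H k).
Proof.
by move=> kl; apply/eqP; rewrite -addr_eq0 cl (negbTE kl) mulr0n raddf0.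
Qed.

Lemma clifford_sum_sqr (v : 'I_n -> R) :
  (\sum_k v k *: H k) *m (\sum_k v k *: H k) = - (\sum_k v k ^+ 2)%:M.
Proof.
have two0 : (2 : R) != 0 by rewrite pnatr_eq0.
pose P k l := (v k * v l) *: (H k *m H l).
have E : (\sum_k v k *: H k) *m (\sum_k v k *: H k) = \sum_k \sum_l P k l.
  rewrite mulmx_suml; apply: eq_bigr => k _; rewrite mulmx_sumr.
  by apply: eq_bigr => l _; rewrite -scalemxAl -scalemxAr scalerA.
apply: (scalerI two0); rewrite scaler_nat mulr2n E {2}exchange_big /= -big_split /=.
rewrite raddf_sum -sumrN scaler_sumr; apply: eq_bigr => k _; rewrite -big_split /=.
rewrite (bigD1 k) //= big1 => [|l lk]; last first.
  by rewrite /P (mulrC (v l)) -scalerDr cl eq_sym (negbTE lk) mulr0n raddf0 scaler0.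
rewrite addr0 /P -scalerDr cl eqxx mulr1n scale_scalar_mx scalerN scale_scalar_mx.
by rewrite -raddfN /= expr2 mulrN mulrC.
Qed.
End Clifford.

Lemma two_other_indices n : (3 <= n)%N -> forall k : 'I_n,
  exists l m : 'I_n, [/\ k != l, k != m & l != m].
Proof.
move=> n3 k; have : (1 < #|predC1 k|)%N.
  by rewrite cardC1 card_ord; case: n n3 k => [|[|[|]]].
case/card_gt1P => l [m [lk mk lm]]; exists l, m; split => //.
  by move: lk; rewrite !inE eq_sym.
by move: mk; rewrite !inE eq_sym.
Qed.

(** The antisymmetrised products determine each factor as soon as there are
    three directions: with c k = H k *m X k they give all sums c k + c l with
    k != l, and 2 c k = (c k + c l) + (c k + c m) - (c l + c m). *)
Lemma clifford_antisym_solve (R : numFieldType) n N q (H : 'I_n -> 'M[R]_N)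
    (X : 'I_n -> 'M[R]_(N, q)) k l m : clifford_family H ->
  k != l -> k != m -> l != m ->
  let W i j := H i *m X j - H j *m X i in
  X k = - 2^-1 *: (H k *m (H k *m H l *m W k l + H k *m H m *m W k m
                           - H l *m H m *m W l m)).
Proof.
move=> cl kl km lm W.
have sum i j : i != j -> H i *m H j *m W i j = H i *m X i + H j *m X j.
  move=> ij.
  have A : H i *m H j *m H i = H j.
    rewrite (clifford_anti cl ij) mulNmx -mulmxA (clifford_sqr cl).
    by rewrite mulmxN mulmx1 opprK.
  have B : H i *m H j *m H j = - H i.
    by rewrite -mulmxA (clifford_sqr cl) mulmxN mulmx1.
  by rewrite mulmxBr !mulmxA A B mulNmx opprK addrC.
rewrite !sum //; set a := H k *m X k.
have -> : a + H l *m X l + (a + H m *m X m) - (H l *m X l + H m *m X m) = 2 *: a.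
  rewrite addrACA addrK scaler_nat mulr2n //.
rewrite -scalemxAr scalerA mulNr mulVf ?pnatr_eq0 // /a mulmxA.
by rewrite (clifford_sqr cl) mulNmx mul1mx scaleN1r opprK.
Qed.

(** * The prolonged twistor system on an open set of R^n *)

Lemma partial_mxE (R : realType) n p q (f : 'rV[R]_n -> 'M[R]_(p, q)) a y i j :
  partial_mx a f y i j = 'D_(axis a) (fun z => f z i j) y.
Proof. exact: mxE. Qed.

Section System.
Context {R : realType} {n N q : nat}.
Hypothesis n3 : (3 <= n)%N.
Variable U : set 'rV[R]_n.
Hypothesis oU : open U.
Variables (F Finv : 'I_n -> 'I_n -> 'rV[R]_n -> R).
Variables (H : 'I_n -> 'M[R]_N) (Gam : 'I_n -> 'rV[R]_n -> 'M[R]_N).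
Variables (phi psi : 'rV[R]_n -> 'M[R]_(N, q)).
Hypothesis cl : clifford_family H.
Hypothesis C1F : forall k a, C1 U (F k a).
Hypothesis cFinv : forall x, U x -> forall a k, {for x, continuous (Finv a k)}.
Hypothesis FinvF : forall y, U y -> forall a b,
  \sum_k Finv a k y * F k b y = (a == b)%:R.
Hypothesis C1Gam : forall k, C1mx U (Gam k).
Hypothesis C1phi : C1mx U phi.
Hypothesis C1dphi : forall a, C1mx U (partial_mx a phi).

Definition frame_der (f : 'rV[R]_n -> 'M[R]_(N, q)) k y :=
  \sum_a F k a y *: partial_mx a f y.

Hypothesis sys : forall k y, U y ->
  frame_der phi k y + Gam k y *m phi y + H k *m psi y = 0.

Lemma partial_mx_frame f y a : U y ->
  partial_mx a f y = \sum_k Finv a k y *: frame_der f k y.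
Proof.
move=> Uy; under eq_bigr => k _ do rewrite scaler_sumr.
rewrite exchange_big /= (bigD1 a) //= [X in _ + X]big1 => [|b ba].
  under eq_bigr do rewrite scalerA.
  by rewrite -scaler_suml FinvF // eqxx scale1r addr0.
under eq_bigr do rewrite scalerA.
by rewrite -scaler_suml FinvF // eq_sym (negbTE ba) scale0r.
Qed.

Lemma partial_mx_comm y a b : U y ->
  partial_mx b (partial_mx a phi) y = partial_mx a (partial_mx b phi) y.
Proof.
move=> Uy; apply/matrixP => i j; rewrite [LHS]partial_mxE [RHS]partial_mxE.
have E c : (fun z => partial_mx c phi z i j) = 'D_(axis c) (fun z => phi z i j).
  by apply/funext => z; rewrite partial_mxE.
have C c : C1 U ('D_(axis c) (fun z => phi z i j)).
  by rewrite -E; exact: C1dphi.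
rewrite (E a) (E b); apply: derive_comm.
- apply: filterS (near_open oU Uy) => z Uz.
  have D c := @ex_derive _ _ _ _ _ _ _ (C1_derive c (C1phi i j) Uz).
  have D2 c d := @ex_derive _ _ _ _ _ _ _ (C1_derive d (C c) Uz).
  by split.
- exact: C1_derive_continuous (C a) Uy.
- exact: C1_derive_continuous (C b) Uy.
Qed.

(** What the derivative of equation k along the l-th frame vector contributes
    besides the second derivatives of phi and the derivative of psi. *)
Definition lower_terms l k y :=
  \sum_c F l c y *: (\sum_a 'D_(axis c) (F k a) y *: partial_mx a phi y
     + (partial_mx c (Gam k) y *m phi y + Gam k y *m partial_mx c phi y)).

(** Equation l is differentiated along frame vector k and conversely; the
    difference cancels the second derivatives of phi because they commute. *)
Lemma curvature_identity (C1psi : C1mx U psi) k l y : U y ->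
  H k *m frame_der psi l y - H l *m frame_der psi k y
  = lower_terms k l y - lower_terms l k y.
Proof.
move=> Uy.
pose S l k := \sum_c F l c y *: \sum_a F k a y *: partial_mx c (partial_mx a phi) y.
have Ssym : S l k = S k l.
  rewrite /S; under eq_bigr do rewrite scaler_sumr.
  under [RHS]eq_bigr do rewrite scaler_sumr.
  rewrite exchange_big /=; apply: eq_bigr => a _; apply: eq_bigr => c _.
  by rewrite !scalerA mulrC partial_mx_comm.
have der l' k' : lower_terms l' k' y + S l' k' + H k' *m frame_der psi l' y = 0.
  rewrite /frame_der mulmx_sumr /lower_terms /S -!big_split /=.
  apply: big1 => c _; rewrite -scalemxAr -!scalerDr.
  have E := is_partial_mx_zero _ (is_partial_mxD (is_partial_mxD
      (is_partial_mx_sum (index_enum 'I_n) (fun a =>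
        is_partial_mxZ (C1_derive c (C1F k' a) Uy) (C1mx_partial c (C1dphi a) Uy)))
      (is_partial_mxM (C1mx_partial c (C1Gam k') Uy) (C1mx_partial c C1phi Uy)))
      (is_partial_mxMl (H k') (C1mx_partial c C1psi Uy))).
  rewrite big_split /= in E.
  rewrite -[RHS](scaler0 _ (F l' c y)) -[in RHS]E; last first.
    by apply: filterS (near_open oU Uy) => z Uz; exact: sys.
  congr (_ *: (_ + _)).
  exact: addrAC.
have [A B] := (der l k, der k l).
have {}A : H k *m frame_der psi l y = - (lower_terms l k y + S l k).
  by apply/eqP; rewrite -addr_eq0 addrC A.
have {}B : H l *m frame_der psi k y = - (lower_terms k l y + S k l).
  by apply/eqP; rewrite -addr_eq0 addrC B.
by rewrite A B Ssym opprK addrC opprD addrACA subrr addr0.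
Qed.

(** The first derivatives of phi are combinations of phi and psi by the system
    itself, those of psi by curvature_identity and clifford_antisym_solve; the
    coefficients are continuous, so vanish_of_dominated applies to the entries of
    both matrices. *)
Lemma vanish_near (C1psi : C1mx U psi) x0 : U x0 -> phi x0 = 0 -> psi x0 = 0 ->
  \forall y \near x0, phi y = 0.
Proof.
move=> Ux phi0 psi0.
pose u (t : bool * ('I_N * 'I_q)) y :=
  (if t.1 then phi y else psi y) t.2.1 t.2.2.
pose w y := \sum_t `|u t y|.
have u_dom t : dominated x0 w (u t).
  exists 1; apply: filterE => y; rewrite mul1r /w (bigD1 t) //= lerDl.
  by apply: sumr_ge0.
have dphi : dominated_mx x0 w phi by move=> i j; exact: (u_dom (true, (i, j))).
have dpsi : dominated_mx x0 w psi by move=> i j; exact: (u_dom (false, (i, j))).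
have cGam k : continuous_mx x0 (Gam k).
  by move=> i j; exact: C1_continuous (C1Gam k i j) Ux.
have cdGam k c : continuous_mx x0 (partial_mx c (Gam k)).
  move=> i j; apply: continuous_near_eq (C1_derive_continuous (C1Gam k i j) Ux).
  by apply: filterE => y; rewrite partial_mxE.
have near_sys k : \forall y \near x0,
    - (Gam k y *m phi y + H k *m psi y) = frame_der phi k y.
  apply: filterS (near_open oU Ux) => y Uy.
  by apply/esym/eqP; rewrite -addr_eq0 addrA sys.
have dgrad f : (forall k, dominated_mx x0 w (frame_der f k)) ->
    forall a, dominated_mx x0 w (partial_mx a f).
  move=> df a; apply: (dominated_mx_eq
    (F := fun y => \sum_k Finv a k y *: frame_der f k y)).
    by apply: filterS (near_open oU Ux) => y Uy; rewrite -partial_mx_frame.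
  by apply: dominated_mx_sum => k; apply: dominated_mxZ => //; exact: cFinv.
have dphi1 : forall a, dominated_mx x0 w (partial_mx a phi).
  apply: dgrad => k; apply: dominated_mx_eq (near_sys k) _.
  apply/dominated_mxN/dominated_mxD; first exact: dominated_mxM.
  exact: dominated_mxMl.
have dlower l k : dominated_mx x0 w (lower_terms l k).
  apply: dominated_mx_sum => c; apply: dominated_mxZ => //.
    exact: C1_continuous (C1F l c) Ux.
  apply: dominated_mxD; last by apply: dominated_mxD; exact: dominated_mxM.
  apply: dominated_mx_sum => a; apply: dominated_mxZ => //.
  exact: C1_derive_continuous (C1F k a) Ux.
pose W k l y := H k *m frame_der psi l y - H l *m frame_der psi k y.
have dW k l : dominated_mx x0 w (W k l).
  apply: (dominated_mx_eq (F := fun y => lower_terms k l y - lower_terms l k y)).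
    apply: filterS (near_open oU Ux) => y Uy.
    by rewrite /W (curvature_identity C1psi).
  by apply: dominated_mxD => //; exact: dominated_mxN.
have dpsi1 : forall a, dominated_mx x0 w (partial_mx a psi).
  apply: dgrad => k; have [l [m [kl km lm]]] := two_other_indices n3 k.
  apply: (dominated_mx_eq (F := fun y => - 2^-1 *: (H k *m
      (H k *m H l *m W k l y + H k *m H m *m W k m y - H l *m H m *m W l m y)))).
    apply: filterE => y; apply/esym.
    exact: (clifford_antisym_solve (fun k => frame_der psi k y) cl kl km lm).
  apply: dominated_mxZ; first exact: cst_continuous.
  apply: dominated_mxMl => //; apply: dominated_mxD => //.
    by apply: dominated_mxD => //; exact: dominated_mxMl.
  by apply: dominated_mxN => //; exact: dominated_mxMl.
have C1u t : C1 U (u t) by rewrite /u; case: (t.1).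
have : \forall y \near x0, forall t, u t y = 0.
  apply: vanish_of_dominated.
  - apply: filterS (near_open oU Ux) => y Uy t a.
    exact: @ex_derive _ _ _ _ _ _ _ (C1_derive a (C1u t) Uy).
  - by move=> t; exact: C1_continuous (C1u t) Ux.
  - move=> [[] [i j]] a; [have [C hC] := dphi1 a i j|have [C hC] := dpsi1 a i j].
      by exists C; apply: filterS hC => y; rewrite partial_mxE.
    by exists C; apply: filterS hC => y; rewrite partial_mxE.
  - by move=> [[] [i j]]; rewrite /u /= ?phi0 ?psi0 mxE.
by apply: filterS => y uy; apply/matrixP => i j; rewrite mxE; exact: (uy (true, (i, j))).
Qed.

(** At a zero, the differential of phi sends h to - V psi, where V is Clifford
    multiplication by h; as V squares to minus the squared length of h, this is
    bounded below in h, and the mean value theorem does the rest. *)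
Lemma isolated_near x0 : U x0 -> phi x0 = 0 -> psi x0 != 0 ->
  \forall y \near x0, phi y = 0 -> y = x0.
Proof.
move=> Ux phi0 psi0.
have [p [r pr0]] : exists p r, psi x0 p r != 0.
  by move/matrix0Pn : psi0.
pose K := \sum_k \sum_i \sum_j `|H k i j|.
pose L := \sum_k \sum_b `|F k b x0|.
have K0 : 0 <= K by apply: sumr_ge0 => k _; apply: sumr_ge0 => i _; apply: sumr_ge0.
have L0 : 0 <= L by apply: sumr_ge0 => k _; apply: sumr_ge0.
(* With mu the length of h in the frame, the entries of V are at most mu K and
   those of h at most mu L; an oscillation e of the partial derivatives then gives
   mu^2 |psi x0 p r| <= mu^2 Q e, which is too small for the e below. *)
pose Q := N%:R * K * (n%:R * L).
have Q0 : 0 <= Q by rewrite !mulr_ge0.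
pose e := `|psi x0 p r| / (Q + 1).
have e0 : 0 < e by rewrite divr_gt0 ?normr_gt0 // ltr_wpDl.
have near_e : \forall y \near x0, forall a i,
    `|partial_mx a phi y i r - partial_mx a phi x0 i r| <= e.
  apply: near_forall => a; apply: near_forall => i.
  have : {for x0, continuous (fun y => partial_mx a phi y i r)}.
    exact: C1_continuous (C1dphi a i r) Ux.
  move=> /cvgrPdist_le /(_ _ e0); apply: filterS => y; first by rewrite distrC.
have /near_boxP[rho rho0 hrho] := near_and (near_open oU Ux) near_e.
apply/near_boxP; exists rho => // y yrho phiy.
pose h a := y 0 a - x0 0 a.
(* The components of h in the frame. *)
pose v k := \sum_a h a * Finv a k x0.
have hE b : h b = \sum_k v k * F k b x0.
  transitivity (\sum_a h a * (a == b)%:R).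
    rewrite (bigD1 b) //= eqxx mulr1 big1 ?addr0 // => a /negbTE->.
    by rewrite mulr0.
  under [RHS]eq_bigr do rewrite mulr_suml.
  rewrite exchange_big /=; apply: eq_bigr => a _.
  by rewrite -(FinvF Ux) mulr_sumr; apply: eq_bigr => k _; rewrite mulrA.
pose mu := Num.sqrt (\sum_k v k ^+ 2).
have sum0 : 0 <= \sum_k v k ^+ 2 by apply: sumr_ge0 => k _; exact: sqr_ge0.
have vmu k : `|v k| <= mu.
  rewrite -sqrtr_sqr ler_sqrt // (bigD1 k) //= lerDl.
  by apply: sumr_ge0 => l _; exact: sqr_ge0.
have hmu b : `|h b| <= mu * L.
  rewrite hE (le_trans (ler_norm_sum _ _ _)) // mulr_sumr.
  apply: ler_sum => k _; rewrite normrM ler_pM //.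
  by rewrite (bigD1 b) //= lerDl sumr_ge0.
have [mu0|mu0] := eqVneq mu 0.
  apply/rowP => b; apply/eqP; rewrite -subr_eq0 -normr_le0 -/(h b).
  by rewrite (le_trans (hmu b)) // mu0 mul0r.
have {}mu0 : 0 < mu by rewrite lt_def mu0 sqrtr_ge0.
pose V := \sum_k v k *: H k.
(* The differential of phi at x0 applied to h. *)
pose B := \sum_a h a *: partial_mx a phi x0.
have Vmu i j : `|V i j| <= mu * K.
  rewrite summxE (le_trans (ler_norm_sum _ _ _)) // mulr_sumr.
  apply: ler_sum => k _; rewrite mxE normrM ler_pM //.
  rewrite (bigD1 i) //= (bigD1 j) //= -addrA lerDl addr_ge0 //.
    exact: sumr_ge0.
  by apply: sumr_ge0 => *; exact: sumr_ge0.
have BE : B = - (V *m psi x0).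
  rewrite /B; under eq_bigr => a _ do rewrite (partial_mx_frame _ _ Ux) scaler_sumr.
  rewrite exchange_big /= mulmx_suml -sumrN; apply: eq_bigr => k _.
  have -> : frame_der phi k x0 = - (H k *m psi x0).
    have := sys k Ux; rewrite phi0 mulmx0 addr0 => /eqP.
    by rewrite addr_eq0 => /eqP.
  under eq_bigr do rewrite scalerA.
  by rewrite -scaler_suml scalerN -scalemxAl.
have Bsmall i : `|B i r| <= n%:R * (mu * L * e).
  have [z hz E] := @mvt_box R n (fun y => phi y i r) x0 rho y
      (fun z a hz => @ex_derive _ _ _ _ _ _ _
        (C1_derive a (C1phi i r) (hrho z hz).1)) yrho.
  have -> : B i r = - \sum_a h a * (partial_mx a phi (z a) i r - partial_mx a phi x0 i r).
    move: E; rewrite phiy phi0 !mxE subrr => E.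
    apply/eqP; rewrite summxE -addr_eq0 -big_split /=; apply/eqP; rewrite [RHS]E.
    by apply: eq_bigr => a _; rewrite mxE partial_mxE /h; ring.
  rewrite normrN (le_trans (ler_norm_sum _ _ _)) //.
  rewrite mulr_natl -[X in _ <= _ *+ X]card_ord -sumr_const.
  apply: ler_sum => a _; rewrite normrM ler_pM // (hrho (z a) _).2 //.
  exact: le_lt_trans (hz a) yrho.
have VB : V *m B = mu ^+ 2 *: psi x0.
  rewrite BE mulmxN mulmxA clifford_sum_sqr // sqr_sqrtr //.
  by rewrite mulNmx opprK mul_scalar_mx.
have : mu ^+ 2 * `|psi x0 p r| <= mu ^+ 2 * (Q * e).
  have -> : mu ^+ 2 * `|psi x0 p r| = `|(V *m B) p r|.
    by rewrite VB mxE normrM (ger0_norm (sqr_ge0 mu)).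
  rewrite mxE (le_trans (ler_norm_sum _ _ _)) //.
  have -> : mu ^+ 2 * (Q * e) = \sum_(i < N) (mu * K) * (n%:R * (mu * L * e)).
    by rewrite sumr_const card_ord -[RHS]mulr_natl /Q; ring.
  by apply: ler_sum => i _; rewrite normrM ler_pM.
rewrite ler_pM2l ?exprn_gt0 // => le1.
have : Q * e < `|psi x0 p r|.
  rewrite /e mulrCA gtr_pMr ?normr_gt0 // ltr_pdivrMr ?mul1r ?ltrDl //.
  by rewrite ltr_wpDl.
by rewrite ltNge le1.
Qed.
End System.

(** The system expresses psi through phi and its first derivatives, which is where
    psi gets its regularity from. *)
Theorem local_dichotomy (R : realType) (n N q : nat) (n3 : (3 <= n)%N)
    (U : set 'rV[R]_n) (F Finv : 'I_n -> 'I_n -> 'rV[R]_n -> R)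
    (H : 'I_n -> 'M[R]_N) (Gam : 'I_n -> 'rV[R]_n -> 'M[R]_N)
    (phi psi : 'rV[R]_n -> 'M[R]_(N, q)) :
  open U -> clifford_family H -> (forall k a, C1 U (F k a)) ->
  (forall x, U x -> forall a k, {for x, continuous (Finv a k)}) ->
  (forall y, U y -> forall a b, \sum_k Finv a k y * F k b y = (a == b)%:R) ->
  (forall k, C1mx U (Gam k)) -> C1mx U phi -> (forall a, C1mx U (partial_mx a phi)) ->
  (forall k y, U y ->
     frame_der F phi k y + Gam k y *m phi y + H k *m psi y = 0) ->
  forall x0, U x0 -> phi x0 = 0 ->
  (\forall y \near x0, phi y = 0) \/ (\forall y \near x0, phi y = 0 -> y = x0).
Proof.
move=> oU cl C1F cFinv FinvF C1Gam C1phi C1dphi sys x0 Ux phi0.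
have [psi0|psi0] := eqVneq (psi x0) 0; last first.
  right;  exact: (isolated_near oU cl FinvF C1phi C1dphi sys Ux phi0 psi0).
left; pose k0 : 'I_n := Ordinal (leq_trans (isT : (0 < 3)%N) n3).
(* On U this is psi, but its smoothness is visible. *)
pose psi' y := H k0 *m (frame_der F phi k0 y + Gam k0 y *m phi y).
have psi'E y : U y -> psi' y = psi y.
  move=> Uy; have /eqP := sys k0 y Uy; rewrite addr_eq0 /psi' => /eqP ->.
  by rewrite mulmxN mulmxA (clifford_sqr cl) mulNmx mul1mx opprK.
have C1psi' : C1mx U psi'.
  apply: (C1mxM oU (@C1mx_cst _ _ U _ _ (H k0))); apply: (C1mxD oU); last first.
    exact: (C1mxM oU (C1Gam k0) C1phi).
  by apply: (C1mx_sum oU) => a _; exact: (C1mxZ oU (C1F k0 a) (C1dphi a)).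
apply: (vanish_near n3 oU cl C1F cFinv FinvF C1Gam C1phi C1dphi (psi := psi')) => //.
  by move=> k y Uy; rewrite psi'E // sys.
by rewrite psi'E.
Qed.

(** * Complex matrices as real ones *)

Section Realification.
Local Open Scope complex_scope.
Context {R : realType}.
Local Notation Re := (@complex.Re R).
Local Notation Im := (@complex.Im R).

Lemma ReD (x y : R[i]) : Re (x + y) = Re x + Re y.
Proof. by case: x y => [? ?] []. Qed.
Lemma ImD (x y : R[i]) : Im (x + y) = Im x + Im y.
Proof. by case: x y => [? ?] []. Qed.
Lemma ReM (x y : R[i]) : Re (x * y) = Re x * Re y - Im x * Im y.
Proof. by case: x y => [? ?] []. Qed.
Lemma ImM (x y : R[i]) : Im (x * y) = Re x * Im y + Im x * Re y.
Proof. by case: x y => [? ?] []. Qed.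
Lemma Re_sum I (r : seq I) (f : I -> R[i]) :
  Re (\sum_(k <- r) f k) = \sum_(k <- r) Re (f k).
Proof. exact: (big_morph _ ReD). Qed.
Lemma Im_sum I (r : seq I) (f : I -> R[i]) :
  Im (\sum_(k <- r) f k) = \sum_(k <- r) Im (f k).
Proof. exact: (big_morph _ ImD). Qed.

(** C^q seen as R^(q+q): a matrix acts by its real and imaginary blocks, a
    vector is the stack of its real and imaginary parts. *)
Definition real_mx p q (B : 'M[R[i]]_(p, q)) : 'M[R]_(p + p, q + q) :=
  block_mx (map_mx Re B) (- map_mx Im B) (map_mx Im B) (map_mx Re B).

Definition real_vec p q (v : 'M[R[i]]_(p, q)) : 'M[R]_(p + p, q) :=
  col_mx (map_mx Re v) (map_mx Im v).

Lemma map_ReM p q r (B : 'M[R[i]]_(p, q)) (C : 'M[R[i]]_(q, r)) :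
  map_mx Re (B *m C) = map_mx Re B *m map_mx Re C - map_mx Im B *m map_mx Im C.
Proof.
apply/matrixP => i j; rewrite !mxE Re_sum -sumrB.
by apply: eq_bigr => k _; rewrite !mxE ReM.
Qed.

Lemma map_ImM p q r (B : 'M[R[i]]_(p, q)) (C : 'M[R[i]]_(q, r)) :
  map_mx Im (B *m C) = map_mx Re B *m map_mx Im C + map_mx Im B *m map_mx Re C.
Proof.
apply/matrixP => i j; rewrite !mxE Im_sum -big_split.
by apply: eq_bigr => k _; rewrite !mxE ImM.
Qed.

Lemma real_mxM p q r (B : 'M[R[i]]_(p, q)) (C : 'M[R[i]]_(q, r)) :
  real_mx (B *m C) = real_mx B *m real_mx C.
Proof.
rewrite /real_mx mulmx_block map_ReM map_ImM !mulNmx !mulmxN opprD.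
by congr block_mx; rewrite addrC.
Qed.

Lemma real_mxMv p q r (B : 'M[R[i]]_(p, q)) (v : 'M[R[i]]_(q, r)) :
  real_vec (B *m v) = real_mx B *m real_vec v.
Proof.
rewrite /real_vec /real_mx mul_block_col map_ReM map_ImM mulNmx.
by congr col_mx; rewrite addrC.
Qed.

Lemma real_mxD p q (B C : 'M[R[i]]_(p, q)) :
  real_mx (B + C) = real_mx B + real_mx C.
Proof.
rewrite /real_mx add_block_mx -opprD.
have E : map_mx Re (B + C) = map_mx Re B + map_mx Re C.
  by apply/matrixP => i j; rewrite !mxE ReD.
have E' : map_mx Im (B + C) = map_mx Im B + map_mx Im C.
  by apply/matrixP => i j; rewrite !mxE ImD.
by rewrite E E'.
Qed.

Lemma real_vecD p q (u v : 'M[R[i]]_(p, q)) :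
  real_vec (u + v) = real_vec u + real_vec v.
Proof.
rewrite /real_vec add_col_mx; congr col_mx; apply/matrixP => i j; rewrite !mxE.
  exact: ReD.
exact: ImD.
Qed.

Lemma real_vec0 p q : real_vec (0 : 'M[R[i]]_(p, q)) = 0.
Proof.
by rewrite /real_vec -[RHS]col_mx0; congr col_mx; apply/matrixP => i j; rewrite !mxE.
Qed.

Lemma real_vec_inj0 p q (v : 'M[R[i]]_(p, q)) : real_vec v = 0 -> v = 0.
Proof.
rewrite /real_vec -[RHS]col_mx0 => /eq_col_mx[/matrixP hR /matrixP hI].
apply/matrixP => i j; move: (hR i j) (hI i j); rewrite !mxE.
by case: (v i j) => a b /= -> ->.
Qed.

Lemma real_vec_sum p q I (r : seq I) (P : pred I) (f : I -> 'M[R[i]]_(p, q)) :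
  real_vec (\sum_(k <- r | P k) f k) = \sum_(k <- r | P k) real_vec (f k).
Proof. exact: (big_morph _ (@real_vecD p q) (@real_vec0 p q)). Qed.

Lemma real_vecZ p q (c : R) (v : 'M[R[i]]_(p, q)) :
  real_vec (c%:C *: v) = c *: real_vec v.
Proof.
rewrite /real_vec scale_col_mx; congr col_mx; apply/matrixP => i j; rewrite !mxE.
  by rewrite ReM /= mul0r subr0.
by rewrite ImM /= mul0r addr0.
Qed.

Lemma real_mx_scalar p (c : R) : real_mx ((c%:C)%:M : 'M[R[i]]_p) = c%:M.
Proof.
rewrite /real_mx [RHS]scalar_mx_block; congr block_mx;
  apply/matrixP => i j; rewrite !mxE; case: eqP => //= _; rewrite ?oppr0 //.
Qed.

Lemma real_clifford n N (H : 'I_n -> 'M[R[i]]_N) :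
  clifford_family H -> clifford_family (fun k => real_mx (H k)).
Proof.
move=> cl k l; rewrite -!real_mxM -real_mxD cl -real_mx_scalar.
congr real_mx; congr scalar_mx.
by case: (k == l); rewrite ?mulr1n ?mulr0n // rmorphN rmorph_nat.
Qed.
End Realification.

(** * Smooth functions in a chart *)

Section Chart.
Context {R : realType} {n : nat} {M : topologicalType}.
Context (A : oriented_atlas R n M) (i : chart A) (V : set M).
Hypotheses (oV : open V) (Vi : V `<=` dom i).
Implicit Types (f : M -> R).

(** Smoothness measured in the single chart i, which makes it stable under the
    partial derivatives of that chart. *)
Definition chart_smooth f := forall (s : seq 'I_n) m, V m ->
  {for m, continuous (foldr (pd i) f s)} /\
  (forall a, derivable (foldr (pd i) f s \o par i) (crd i m) (delta_mx 0 a)).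

Lemma smooth_on_chart W f : V `<=` W -> smooth_on A W f -> chart_smooth f.
Proof. by move=> VW sf s m Vm; apply: sf; [exact: Vi|exact: VW]. Qed.

Lemma chart_smooth_pd a f : chart_smooth f -> chart_smooth (pd i a f).
Proof. by move=> sf s m Vm; have := sf (rcons s a) m Vm; rewrite foldr_rcons. Qed.

Definition chart_image : set 'rV[R]_n := crd i @` V.

Lemma chart_imageP y : chart_image y -> V (par i y) /\ crd i (par i y) = y.
Proof. by move=> [m Vm <-]; rewrite (crdK (Vi Vm)). Qed.

Lemma chart_image_crd m : V m -> chart_image (crd i m).
Proof. by move=> Vm; exists m. Qed.

Lemma open_chart_image : open chart_image.
Proof.
rewrite openE => _ [m Vm <-]; rewrite /interior.
have Dm := Vi Vm.
have h1 : \forall y \near crd i m, (crd i @` dom i) y.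
  by apply: near_open; [exact: crd_open|exists m].
have h2 : \forall y \near crd i m, V (par i y).
  have := par_continuous Dm; rewrite /prop_for /continuous_at crdK // => H.
  by apply: H; exact: near_open.
apply: filterS (near_and h1 h2) => _ [[m' Dm' <-]].
by rewrite crdK // => Vm'; exists m'.
Qed.

Lemma derive_par a f y : chart_image y ->
  'D_(axis a) (fun z => f (par i z)) y = pd i a f (par i y).
Proof. by move=> /chart_imageP[_ E]; rewrite /pd E. Qed.

Lemma continuous_par f y : chart_image y -> {for par i y, continuous f} ->
  {for y, continuous (fun z => f (par i z))}.
Proof.
move=> Uy cf; have [Vy E] := chart_imageP Uy.
have := par_continuous (Vi Vy); rewrite E => cp.
exact: (continuous_comp cp cf).
Qed.

Lemma chart_smooth_C1 f : chart_smooth f ->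
  C1 chart_image (fun y => f (par i y)).
Proof.
move=> sf y Uy; have [Vy E] := chart_imageP Uy.
split=> [|a].
  by apply: continuous_par => //; case: (sf [::] _ Vy).
split; first by have [_ /(_ a)] := sf [::] _ Vy; rewrite E.
apply: (@continuous_near_eq _ _ (fun z => pd i a f (par i z))).
  by apply: filterS (near_open open_chart_image Uy) => z /derive_par ->.
by apply: continuous_par => //; case: (sf [:: a] _ Vy).
Qed.
End Chart.

(** * The twistor equation in a frame *)

Section TwistorInFrame.
Local Open Scope complex_scope.
Context {R : realType} {n : nat} {M : topologicalType}.
Context (A : oriented_atlas R n M) (g : riemannian_metric A).
Context (G : spinor_module R n) (S : spin_structure g G) (T : three_form A).
Variables (s : R) (phi : spinor_field S) (t : triv S) (i : chart A).

Let V := triv_dom t `&` dom i.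
Let Vi : V `<=` dom i. Proof. by move=> m []. Qed.
Let Vt : V `<=` triv_dom t. Proof. by move=> m []. Qed.
Let oV : open V.
Proof. by apply: openI; [exact: triv_open|exact: dom_open]. Qed.
Let U := chart_image i V.
Let oU : open U. Proof. exact: open_chart_image. Qed.

Let UV y : U y -> V (par i y). Proof. by move=> /(chart_imageP Vi)[]. Qed.

(** Orthonormality F g F^T = 1 gives both inverses without a division: F^-1 is
    g F^T and g^-1 is F^T F, so their smoothness is immediate. *)
Lemma frame_inverse m : V m ->
  g i m *m (frame t i m)^T *m frame t i m = 1%:M.
Proof.
by move=> [tm im]; apply: mulmx1C; rewrite mulmxA frame_orthonormal.
Qed.

Lemma metric_inv_frame m : V m ->
  metric_inv g i m = (frame t i m)^T *m frame t i m.
Proof.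
move=> Vm; have E := frame_inverse Vm; rewrite -mulmxA in E.
have [gu _] := mulmx1_unit E.
by rewrite -[RHS](mulKmx gu) E mulmx1.
Qed.

Lemma clifford_vec_frame m k : V m ->
  clifford_mul t i m (frame_vec t i m k) = G k.
Proof.
move=> [tm im]; rewrite /clifford_mul /frame_vec -!row_mul frame_orthonormal //.
rewrite /clifford_vec (bigD1 k) //= big1 => [|l lk].
  by rewrite !mxE eqxx scale1r addr0.
by rewrite !mxE eq_sym (negbTE lk) scale0r.
Qed.

(** The coefficient of e_k'.e_l in nabla^s along e_k. *)
Definition spin_coef m (k k' l : 'I_n) : R :=
  2^-1 * (cov_frame t i m (frame_vec t i m k) k' *m g i m
          *m (frame_vec t i m l)^T) 0 0
  + s * form_eval T i m (frame_vec t i m k) (frame_vec t i m k')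
          (frame_vec t i m l).

Lemma nabla_s_frame m k :
  nabla_s T s phi t i m (frame_vec t i m k) =
  \sum_a (frame t i m k a)%:C *: (\col_p pdC i a (fun x => phi t x p 0) m)
  + (\sum_(k' < n) \sum_(l < n | (k' < l)%N)
       (spin_coef m k k' l)%:C *: (G k' *m G l)) *m phi t m.
Proof.
rewrite /nabla_s /nabla_g /clifford_contr -addrA; congr (_ + _).
  by apply: eq_bigr => a _; rewrite mxE.
rewrite scaler_sumr !mulmx_suml scaler_sumr -big_split /=.
apply: eq_bigr => k' _; rewrite scaler_sumr !mulmx_suml scaler_sumr -big_split /=.
apply: eq_bigr => l _; rewrite -!scalemxAl !scalerA -scalerDl; congr (_ *: _).
rewrite /spin_coef rmorphD !rmorphM /=; congr (_ * _ + _).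
by rewrite fmorphV rmorph_nat.
Qed.

Let C1frame k a : C1 U (fun y => frame t i (par i y) k a).
Proof.
apply: (chart_smooth_C1 oV Vi (f := fun m => frame t i m k a)).
exact: (smooth_on_chart Vi (fun _ h => h) (@frame_smooth _ _ _ _ _ _ S t i k a)).
Qed.

Let C1pdframe b k a : C1 U (fun y => pd i b (fun x => frame t i x k a) (par i y)).
Proof.
apply: (chart_smooth_C1 oV Vi
  (f := fun m => pd i b (fun x => frame t i x k a) m)).
apply: chart_smooth_pd.
exact: (smooth_on_chart Vi (fun _ h => h) (@frame_smooth _ _ _ _ _ _ S t i k a)).
Qed.

Let C1metric a b : C1 U (fun y => g i (par i y) a b).
Proof.
apply: (chart_smooth_C1 oV Vi (f := fun m => g i m a b)).
exact: (smooth_on_chart Vi Vi (@metric_smooth _ _ _ _ g i a b)).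
Qed.

Let C1pdmetric c a b : C1 U (fun y => pd i c (fun x => g i x a b) (par i y)).
Proof.
apply: (chart_smooth_C1 oV Vi
  (f := fun m => pd i c (fun x => g i x a b) m)).
apply: chart_smooth_pd.
exact: (smooth_on_chart Vi Vi (@metric_smooth _ _ _ _ g i a b)).
Qed.

Let C1form a b c : C1 U (fun y => T i (par i y) a b c).
Proof.
apply: (chart_smooth_C1 oV Vi (f := fun m => T i m a b c)).
exact: (smooth_on_chart Vi Vi (@form_smooth _ _ _ _ T i a b c)).
Qed.

Let C1christoffel a b c : C1 U (fun y => levi_civita g i (par i y) a b c).
Proof.
apply: (C1M oU (@C1_cst _ _ U _)); apply: (C1_sum oU) => d _; apply: (C1M oU).
  apply: (C1_eq oU
    (f := fun y => \sum_k frame t i (par i y) k c * frame t i (par i y) k d)).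
    move=> y /UV Vy; rewrite metric_inv_frame // mxE.
    by apply: eq_bigr => k _; rewrite mxE.
  by apply: (C1_sum oU) => k _; exact: (C1M oU).
exact: (C1D oU (C1D oU (C1pdmetric _ _ _) (C1pdmetric _ _ _))
  (C1N oU (C1pdmetric _ _ _))).
Qed.

Lemma C1_spin_coef k k' l : C1 U (fun y => spin_coef (par i y) k k' l).
Proof.
apply: (C1D oU); apply: (C1M oU (@C1_cst _ _ U _)).
  pose cov y := cov_frame t i (par i y) (frame_vec t i (par i y) k) k'.
  have C1cov : C1mx U cov.
    move=> p c; apply: (C1_eq oU (f := fun y => \sum_a frame t i (par i y) k a *
      (pd i a (fun x => frame t i x k' c) (par i y)
       + \sum_b levi_civita g i (par i y) a b c * frame t i (par i y) k' b))).
      by move=> y _; rewrite /cov mxE; apply: eq_bigr => a _; rewrite mxE.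
    apply: (C1_sum oU) => a _; apply: (C1M oU) => //; apply: (C1D oU) => //.
    by apply: (C1_sum oU) => b _; exact: (C1M oU).
  have C1g : C1mx U (fun y => g i (par i y)) by [].
  have C1f : C1mx U (fun y => (frame_vec t i (par i y) l)^T).
    move=> a p; apply: C1_eq (C1frame l a) => // y _; by rewrite !mxE.
  exact: (C1mxM oU (C1mxM oU C1cov C1g) C1f 0 0).
apply: (C1_sum oU) => a _; apply: (C1_sum oU) => b _; apply: (C1_sum oU) => c _.
apply: (C1_eq oU (f := fun y => frame t i (par i y) k a *
  frame t i (par i y) k' b * frame t i (par i y) l c * T i (par i y) a b c)).
  by move=> y _; rewrite !mxE.
exact: (C1M oU (C1M oU (C1M oU (C1frame k a) (C1frame k' b)) (C1frame l c))).
Qed.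

(* The spinor field and D^s(phi) / n in the chart, as real vectors. *)
Let phiR y := real_vec (phi t (par i y)).
Let psiR y := real_vec (n%:R^-1 *: dirac_s T s phi t i (par i y)).
Let GamR k y := \sum_(k' < n) \sum_(l < n | (k' < l)%N)
  spin_coef (par i y) k k' l *: real_mx (G k' *m G l).

Let smooth_part (part : R[i] -> R) p :=
  chart_smooth i V (fun m => part (phi t m p 0)).

Let smoothRe p : smooth_part (@complex.Re R) p.
Proof. exact: (smooth_on_chart Vi Vt (spinor_smooth phi t p).1). Qed.

Let smoothIm p : smooth_part (@complex.Im R) p.
Proof. exact: (smooth_on_chart Vi Vt (spinor_smooth phi t p).2). Qed.

Lemma partial_mx_spinor a y : U y ->
  partial_mx a phiR y = real_vec (\col_p pdC i a (fun x => phi t x p 0) (par i y)).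
Proof.
move=> Uy; apply/matrixP => p j; rewrite partial_mxE ord1 /real_vec.
case: (split_ordP p) => p' ->.
  rewrite col_mxEu !mxE /= -(derive_par Vi a (fun x => complex.Re _) Uy).
  congr (derive _ y (axis a)); apply/funext => z.
  by rewrite /phiR /real_vec col_mxEu mxE.
rewrite col_mxEd !mxE /= -(derive_par Vi a (fun x => complex.Im _) Uy).
congr (derive _ y (axis a)); apply/funext => z.
by rewrite /phiR /real_vec col_mxEd mxE.
Qed.

Let C1phiR : C1mx U phiR.
Proof.
move=> p j; rewrite ord1; case: (split_ordP p) => p' ->.
  apply: C1_eq (chart_smooth_C1 oV Vi (smoothRe p')) => // y _.
  by rewrite /phiR /real_vec col_mxEu mxE.
apply: C1_eq (chart_smooth_C1 oV Vi (smoothIm p')) => // y _.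
by rewrite /phiR /real_vec col_mxEd mxE.
Qed.

Let C1dphiR a : C1mx U (partial_mx a phiR).
Proof.
move=> p j; rewrite ord1; case: (split_ordP p) => p' ->.
  apply: C1_eq (chart_smooth_C1 oV Vi (chart_smooth_pd a (smoothRe p'))) => // y Uy.
  by rewrite partial_mx_spinor // /real_vec col_mxEu !mxE.
apply: C1_eq (chart_smooth_C1 oV Vi (chart_smooth_pd a (smoothIm p'))) => // y Uy.
by rewrite partial_mx_spinor // /real_vec col_mxEd !mxE.
Qed.

Let C1GamR k : C1mx U (GamR k).
Proof.
apply: (C1mx_sum oU) => k' _; apply: (C1mx_sum oU) => l _.
exact: (C1mxZ oU (C1_spin_coef k k' l) (@C1mx_cst _ _ U _ _ _)).
Qed.

Hypothesis twist : twistor_spinor T s phi.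

Lemma twistor_real_system k y : U y ->
  frame_der (fun k a y => frame t i (par i y) k a) phiR k y
  + GamR k y *m phiR y + real_mx (G k) *m psiR y = 0.
Proof.
move=> Uy; have [ty iy] := UV Uy.
have := twist (frame_vec t i (par i y) k) ty iy.
rewrite clifford_vec_frame // nabla_s_frame => /(congr1 (@real_vec R _ _)).
rewrite real_vec0 !real_vecD scalemxAr (real_mxMv (G k)) => <-.
congr (_ + _ + _).
  rewrite real_vec_sum; apply: eq_bigr => a _.
  by rewrite real_vecZ partial_mx_spinor.
rewrite !mulmx_suml real_vec_sum; apply: eq_bigr => k' _.
rewrite !mulmx_suml real_vec_sum; apply: eq_bigr => l _.
by rewrite -!scalemxAl real_vecZ real_mxMv.
Qed.

Hypothesis hn : (3 <= n)%N.

Lemma chart_dichotomy m : V m -> phi t m = 0 ->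
  (\forall m' \near m, V m' /\ phi t m' = 0) \/
  (\forall m' \near m, V m' /\ (phi t m' = 0 -> m' = m)).
Proof.
move=> Vm phi0.
have near_crd (P : 'rV[R]_n -> Prop) : (\forall y \near crd i m, P y) ->
    \forall m' \near m, P (crd i m').
  by move=> H; apply: (crd_continuous (Vi Vm)); exact: H.
have x0U : U (crd i m) by exact: chart_image_crd.
have phiR0 : phiR (crd i m) = 0.
  by rewrite /phiR crdK ?phi0 ?real_vec0 //; exact: Vi.
have C1Finv a k : C1 U (fun y => (g i (par i y) *m (frame t i (par i y))^T) a k).
  have C1g : C1mx U (fun y => g i (par i y)) by [].
  have C1f : C1mx U (fun y => (frame t i (par i y))^T).
    by move=> b l; apply: C1_eq (C1frame l b) => // y _; rewrite mxE.
  exact: (C1mxM oU C1g C1f).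
have nV := near_open oV Vm.
have FinvF y : U y -> forall a b,
    \sum_k (g i (par i y) *m (frame t i (par i y))^T) a k
            * frame t i (par i y) k b = (a == b)%:R.
  move=> Uy a b; have := frame_inverse (UV Uy) => /matrixP/(_ a b).
  by rewrite mxE => ->; rewrite mxE.
have cFinv y (Uy : U y) a k := C1_continuous (C1Finv a k) Uy.
have [H|H] := local_dichotomy hn oU (real_clifford (@gamma_clifford R n G))
  C1frame cFinv FinvF C1GamR C1phiR C1dphiR twistor_real_system x0U phiR0.
- left; apply: filterS (near_and nV (near_crd _ H)) => m' [Vm' E]; split=> //.
  by apply: real_vec_inj0; move: E; rewrite /phiR crdK //; exact: Vi.
- right; apply: filterS (near_and nV (near_crd _ H)) => m' [Vm' E]; split=> //.
  move=> phi'0; rewrite -(crdK (Vi Vm')) E ?crdK //; first exact: Vi.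
  by rewrite /phiR crdK ?phi'0 ?real_vec0 //; exact: Vi.
Qed.
End TwistorInFrame.

(** * Zeros on the manifold *)

Section Zeros.
Context {R : realType} {n : nat} {M : topologicalType}.
Context (A : oriented_atlas R n M) (g : riemannian_metric A).
Context (G : spinor_module R n) (S : spin_structure g G) (T : three_form A).
Variables (s : R) (phi : spinor_field S).
Hypothesis hn : (3 <= n)%N.
Hypothesis twist : twistor_spinor T s phi.

(** The cocycle transports zeros from one trivialization to all others. *)
Lemma zero_set_triv t m : triv_dom t m -> zero_set phi m <-> phi t m = 0.
Proof.
move=> tm; split=> [|phi0 t' t'm]; first exact.
by rewrite (spinor_equivariant phi t'm tm) phi0 mulmx0.
Qed.

Lemma zero_dichotomy m : zero_set phi m ->
  (\forall m' \near m, zero_set phi m') \/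
  (\forall m' \near m, zero_set phi m' -> m' = m).
Proof.
move=> zm; have [t tm] := triv_cover S m; have [i im] := dom_cover A m.
have [H|H] := chart_dichotomy twist hn (conj tm im) (zm t tm); [left|right].
  by apply: filterS H => m' [[tm' _] phi0]; apply/(zero_set_triv tm').
by apply: filterS H => m' [[tm' _] E] /(zero_set_triv tm').
Qed.

Lemma continuous_spinor t m p : triv_dom t m ->
  {for m, continuous (fun x => complex.Re (phi t x p 0))} /\
  {for m, continuous (fun x => complex.Im (phi t x p 0))}.
Proof.
move=> tm; have [i im] := dom_cover A m; have [sR sI] := spinor_smooth phi t p.
by split; [case: (sR i [::] m im tm)|case: (sI i [::] m im tm)].
Qed.

Lemma closed_zero_set : closed (zero_set phi).
Proof.
move=> m clm t tm; apply/matrixP => p j; rewrite ord1 mxE.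
have [cR cI] := continuous_spinor p tm.
have zero_of (f : M -> R) : {for m, continuous f} ->
    (forall x, phi t x = 0 -> f x = 0) -> f m = 0.
  move=> cf f0; apply/eqP; rewrite -normr_le0 leNgt; apply/negP => fm.
  move/cvgrPdist_lt: cf => /(_ _ fm) H.
  have [x [zx [tx]]] := clm _ (near_and (near_open (triv_open t) tm) H).
  by rewrite (f0 x (zx t tx)) subr0 ltxx.
apply/eqP; rewrite eq_complex.
by rewrite (zero_of _ cR) ?(zero_of _ cI) ?eqxx // => x ->; rewrite mxE.
Qed.

Lemma isolated_zero_point (connM : connected [set: M])
    (phi0 : exists t m, triv_dom t m /\ phi t m != 0) m :
  zero_set phi m -> isolated (zero_set phi) m.
Proof.
move=> zm; split; first exact/mem_set.
have [zint|] := zero_dichotomy zm; last first.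
  move=> H; exists [set m' | zero_set phi m' -> m' = m] => //.
  apply/seteqP; split=> [m' [/= E zm']|_ ->]; first exact: E.
  by split.
(* The interior of the zero set is closed: a zero in its closure that is isolated
   among the zeros already belongs to it. *)
have [t [m1 [tm1 /eqP[]]]] := phi0.
suff : (zero_set phi)° = [set: M].
  move=> full; have : (zero_set phi)° m1 by rewrite full.
  by move=> /nbhs_singleton; exact.
apply: connM => //.
- by exists m.
- by exists (zero_set phi)°; [exact: open_interior|rewrite setTI].
- exists (zero_set phi)°; last by rewrite setTI.
  move=> m2 clm2.
  have zm2 : zero_set phi m2.
    apply: closed_zero_set; apply: closure_subset clm2; exact: interior_subset.
  have [//|H] := zero_dichotomy zm2.
  have [m3 [zm3 E]] := clm2 _ H.
  by rewrite -(E (interior_subset zm3)).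
Qed.
End Zeros.

Theorem proposition2p7 (R : realType) (n : nat) (hn : (3 <= n)%N)
    (M : topologicalType) (hausM : hausdorff_space M)
    (countM : @second_countable M) (connM : connected [set: M])
    (A : oriented_atlas R n M) (g : riemannian_metric A)
    (G : spinor_module R n) (S : spin_structure g G)
    (T : three_form A) (hT : nontrivial_form T) (parT : parallel_torsion g T)
    (s : R) (phi : spinor_field S)
    (phi0 : exists t m, triv_dom t m /\ phi t m != 0) (twist : twistor_spinor T s phi) :
  forall m : M, zero_set phi m -> isolated (zero_set phi) m.
Proof. exact: (isolated_zero_point hn twist connM phi0). Qed.
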